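(* For any ring $R$ let $\kappa:=(|R|+\aleph_0)^+$, let $\lambda$ be a regular cardinal with $\mu^{|R|+\aleph_0}<\lambda$ for all $\mu<\lambda$, and let $\Gamma$ be the class of $\mathcal{L}_R$-appropriate structures in $[V]^{<\lambda}$ that are $<\kappa$-closed (this class is stationary in $[V]^{<\lambda}$). Then the class $\mathcal{FM}$ of flat Mittag-Leffler $R$-modules has the Kaplansky Property on $\Gamma$. In particular, $\mathcal{FM}$ is a $<\lambda$-Uniformly Stationary Kaplansky class for $\lambda=\left(2^{|R|+\aleph_0}\right)^+$.
   Context: **Flat Mittag-Leffler.** An $R$-module $M$ is flat Mittag-Leffler if it is flat and for every family $(Q_i)_{i\in I}$ of right $R$-modules the canonical map $(\prod_i Q_i)\otimes_R M\to\prod_i(Q_i\otimes_R M)$ is injective. **Stationarity.** $V$ is the universe of sets; a set $N$ is identified with $\mathfrak{N}=(N,\in)$, and $\prec_1$ means $\Sigma_1$-elementarity. $[V]^{<\lambda}$ is the class of sets of size $<\lambda$. For regular uncountable $\lambda$, a class $\Gamma\subseteq[V]^{<\lambda}$ is stationary in $[V]^{<\lambda}$ if for every set $P$ with $|P|<\lambda$ there is $N\in\Gamma$ with $P\subset\mathfrak{N}\prec_1(V,\in)$ and $N\cap\lambda$ an ordinal. $N$ is $<\kappa$-closed if every subset of $N$ of size $<\kappa$ is an element of $N$. **Appropriate.** $\mathcal{L}_R$ is the (finitary) signature of $R$-modules: the signature of abelian groups with a unary function symbol for each $r\in R$. $\mathfrak{N}$ is $\mathcal{L}_R$-appropriate if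 $\mathcal{L}_R\cup\{\mathcal{L}_R\}\subset\mathfrak{N}\prec_1(V,\in)$. **Kaplansky Property.** A class $\mathbf{K}$ of $R$-modules has the Kaplansky Property on $\Gamma$ if for every $\mathfrak{N}\in\Gamma$ and every $K\in\mathfrak{N}\cap\mathbf{K}$, both $\mathfrak{N}\cap K$ (a submodule of $K$) and $K/(\mathfrak{N}\cap K)$ are in $\mathbf{K}$. $\mathbf{K}$ is $<\lambda$-Uniformly Stationary Kaplansky if it has the Kaplansky Property on some stationary $\Gamma\subset[V]^{<\lambda}$. *)

(* Defs.v *)
From HB Require Import structures.
From mathcomp Require Import all_boot all_order all_algebra.
From mathcomp Require Import generic_quotient ring_quotient.
From mathcomp Require Import boolp classical_sets functions cardinality.
From mathcomp.multinomials Require Import freeg.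

Set Implicit Arguments.
Unset Strict Implicit.
Unset Printing Implicit Defensive.

Import GRing.Theory.
Local Open Scope ring_scope.
Local Open Scope quotient_scope.
Local Open Scope classical_set_scope.
Local Open Scope card_scope.

(* Aczel's type of well-founded trees; V is its quotient by extensional
   equality.  With the classical and choice principles of mathcomp-analysis, V
   satisfies ZFC, with replacement for arbitrary functions from V to V. *)
Inductive tree : Type := Tree (A : Type) (f : A -> tree).

Fixpoint tree_eqv (s t : tree) : Prop :=
  match s, t with
  | Tree A f, Tree B g =>
      (forall a, exists b, tree_eqv (f a) (g b)) /\
      (forall b, exists a, tree_eqv (f a) (g b))
  end.

Lemma tree_eqv_refl t : tree_eqv t t.
Proof. by elim: t => A f IH /=; split=> a; exists a. Qed.

Lemma tree_eqv_sym s t : tree_eqv s t -> tree_eqv t s.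
Proof.
elim: s t => A f IH [B g] /= [h1 h2]; split.
- by move=> b; have [a ab] := h2 b; exists a; apply: IH.
- by move=> a; have [b ab] := h1 a; exists b; apply: IH.
Qed.

Lemma tree_eqv_trans t s u : tree_eqv s t -> tree_eqv t u -> tree_eqv s u.
Proof.
elim: t s u => B g IH [A f] [C h] /= [f1 f2] [g1 g2]; split.
- move=> a; have [b ab] := f1 a; have [c bc] := g1 b.
  by exists c; apply: IH ab bc.
- move=> c; have [b bc] := g2 c; have [a ab] := f2 b.
  by exists a; apply: IH ab bc.
Qed.

HB.instance Definition _ := gen_eqMixin tree.
HB.instance Definition _ := gen_choiceMixin tree.

Definition tree_eq : rel tree := fun s t => `[< tree_eqv s t >].

Lemma tree_eq_is_equiv : equiv_class_of tree_eq.
Proof.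
split.
- by move=> t; apply/asboolP; apply: tree_eqv_refl.
- by move=> s t; apply/asboolP/asboolP; apply: tree_eqv_sym.
- move=> t s u /asboolP st /asboolP tu.
  by apply/asboolP; apply: tree_eqv_trans st tu.
Qed.
Canonical tree_eq_equiv := EquivRelPack tree_eq_is_equiv.
Canonical tree_eq_encModRel := defaultEncModRel tree_eq.

Definition V := {eq_quot tree_eq}.
HB.instance Definition _ : EqQuotient tree tree_eq V := EqQuotient.on V.
HB.instance Definition _ := Choice.on V.

Definition vmem (x y : V) : Prop :=
  match repr y with Tree A f => exists a, x = \pi_V (f a) end.
Notation "x ∈ y" := (vmem x y) (at level 70, no associativity).

Definition elts (x : V) : set V := [set y | y ∈ x].

Definition vsup (A : Type) (f : A -> V) : V := \pi_V (Tree (fun a => repr (f a))).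

Lemma piV_eq (s t : tree) : (\pi_V s = \pi_V t) <-> tree_eqv s t.
Proof.
split; first by move=> /eqmodP /asboolP.
by move=> st; apply/eqmodP; apply/asboolP.
Qed.

Lemma elts_vsup (A : Type) (f : A -> V) : elts (vsup f) = range f.
Proof.
rewrite /elts /vsup; apply/seteqP; split => x; rewrite /= /vmem.
- have : tree_eqv (repr (\pi_V (Tree (fun a => repr (f a)))))
                  (Tree (fun a => repr (f a))) by apply/piV_eq; rewrite reprK.
  case: (repr _) => B g /= [h _] [b ->].
  have [a ba] := h b; exists a => //.
  by rewrite -[f a]reprK; apply/esym/piV_eq.
- have : tree_eqv (repr (\pi_V (Tree (fun a => repr (f a)))))
                  (Tree (fun a => repr (f a))) by apply/piV_eq; rewrite reprK.
  case: (repr _) => B g /= [_ h] [a _ <-].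
  have [b ba] := h a; exists b.
  by rewrite -[f a]reprK; apply/esym/piV_eq.
Qed.

Lemma vext (x y : V) : (forall z, z ∈ x <-> z ∈ y) -> x = y.
Proof.
rewrite /vmem -[x in x = y]reprK -[y in _ = y]reprK.
case: (repr x) (repr y) => A f [B g] h; apply/piV_eq; split.
- by move=> a; have [b /piV_eq ab] := (h (\pi_V (f a))).1 (ex_intro _ a erefl); exists b.
- move=> b; have [a /piV_eq ba] := (h (\pi_V (g b))).2 (ex_intro _ b erefl).
  by exists a; apply: tree_eqv_sym.
Qed.

Lemma elts_inj : injective elts.
Proof.
move=> x y xy; apply: vext => z.
by have := congr1 (fun A : set V => A z) xy; rewrite /elts /= => ->.
Qed.

Lemma vmem_ind (P : V -> Prop) :
  (forall x, (forall y, y ∈ x -> P y) -> P x) -> forall x, P x.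
Proof.
move=> H; suff hP t : P (\pi_V t) by move=> x; rewrite -[x]reprK.
elim: t => A f IH; apply: H => y.
have : tree_eqv (repr (\pi_V (Tree f))) (Tree f) by apply/piV_eq; rewrite reprK.
rewrite /vmem; case: (repr _) => B g /= [h _] [b ->].
by have [a /piV_eq ->] := h b.
Qed.

Definition vempty : V := vsup (fun x : void => match x with end).

(* The set whose elements are exactly the members of the class C; the empty
   set if C is a proper class. *)
Definition vset (C : set V) : V := xget vempty [set x | elts x = C].

Lemma elts_vset (C : set V) (x : V) : elts x = C -> elts (vset C) = C.
Proof.
by move=> xC; rewrite /vset; case: xgetP => // /(_ x); rewrite /= xC.
Qed.

Definition vpair (x y : V) : V :=
  vset [set vset [set x]; vset [set x; y]].

Definition small (T : Type) : Prop :=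
  exists (f : T -> V) (x : V), injective f /\ elts x = range f.

Definition card_lt T U (A : set T) (B : set U) : Prop :=
  (A #<= B) /\ ~ (B #<= A).

(* Well-foundedness of the membership relation is automatic in V. *)
Definition is_ordinal (A : set V) : Prop :=
  (forall x, A x -> elts x `<=` A) /\
  (forall x y, A x -> A y -> x ∈ y \/ x = y \/ y ∈ x).

Definition cardinal (c : V) : Prop :=
  is_ordinal (elts c) /\ forall a, a ∈ c -> card_lt (elts a) (elts c).

Definition regular (c : V) : Prop :=
  [/\ cardinal c,
      infinite_set (elts c)
    & forall X : set V, X `<=` elts c ->
        (forall a, a ∈ c -> exists2 b, X b & a = b \/ a ∈ b) ->
        elts c #<= X].

Definition uncountable (c : V) : Prop := ~ countable (elts c).

Definition succ_cardinal_spec T (A : set T) (c : V) : Prop :=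
  [/\ cardinal c, card_lt A (elts c)
    & forall d, cardinal d -> card_lt A (elts d) -> elts c `<=` elts d].

(* The least cardinal greater than |T|, which exists when T is small. *)
Definition succ_cardinal (T : Type) : V :=
  xget vempty (succ_cardinal_spec [set: T]).

(* First-order formulas in the language of set theory, with de Bruijn indices. *)
Inductive formula : Type :=
  | fMem (i j : nat)
  | fEq (i j : nat)
  | fNot (p : formula)
  | fAnd (p q : formula)
  | fEx (p : formula).

Definition scons (x : V) (e : nat -> V) (i : nat) : V :=
  if i is j.+1 then e j else x.

Fixpoint sat (D : set V) (e : nat -> V) (p : formula) : Prop :=
  match p with
  | fMem i j => e i ∈ e j
  | fEq i j => e i = e j
  | fNot p => ~ sat D e p
  | fAnd p q => sat D e p /\ sat D e q
  | fEx p => exists2 x, D x & sat D (scons x e) p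
  end.

(* Bounded universal quantification is obtained through negation; the bounding
   variable i.+1 is never the bound variable 0. *)
Inductive Delta0 : formula -> Prop :=
  | Delta0_mem i j : Delta0 (fMem i j)
  | Delta0_eq i j : Delta0 (fEq i j)
  | Delta0_not p : Delta0 p -> Delta0 (fNot p)
  | Delta0_and p q : Delta0 p -> Delta0 q -> Delta0 (fAnd p q)
  | Delta0_bex i p : Delta0 p -> Delta0 (fEx (fAnd (fMem 0 i.+1) p)).

Inductive Sigma1 : formula -> Prop :=
  | Sigma1_Delta0 p : Delta0 p -> Sigma1 p
  | Sigma1_ex p : Sigma1 p -> Sigma1 (fEx p).

Definition Sigma1_elementary (N : V) : Prop :=
  elts N !=set0 /\
  forall p, Sigma1 p -> forall e, (forall i, e i ∈ N) ->
    (sat (elts N) e p <-> sat setT e p).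

Definition stationary (lam : V) (G : set V) : Prop :=
  [/\ regular lam, uncountable lam,
      (forall N, G N -> card_lt (elts N) (elts lam))
    & forall P : V, card_lt (elts P) (elts lam) ->
        exists N, [/\ G N, elts P `<=` elts N, Sigma1_elementary N
                    & is_ordinal (elts N `&` elts lam)]].

Definition lt_closed (kappa N : V) : Prop :=
  forall x, elts x `<=` elts N -> card_lt (elts x) (elts kappa) -> x ∈ N.

Inductive lmod_symbol (R : Type) : Type :=
  | Szero | Sopp | Sadd | Sscale of R.
Arguments Szero {R}.
Arguments Sopp {R}.
Arguments Sadd {R}.

(* A realization of L_R in V: a choice of pairwise distinct sets as symbols.
   Its existence makes R small. *)
Record signature (R : Type) : Type := Signature {
  sig_set : V;
  sym : lmod_symbol R -> V;
  sym_inj : injective sym;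
  sig_setE : elts sig_set = range sym
}.

Definition appropriate R (L : signature R) (N : V) : Prop :=
  [/\ elts (sig_set L) `<=` elts N, sig_set L ∈ N & Sigma1_elementary N].

Section Coding.
Variables (R : pzRingType) (L : signature R) (M : lmodType R) (f : M -> V).

Definition interp (s : lmod_symbol R) : V :=
  match s with
  | Szero => f 0
  | Sopp => vset (range (fun x => vpair (f x) (f (- x))))
  | Sadd => vset (range (fun z : M * M =>
              vpair (vpair (f z.1) (f z.2)) (f (z.1 + z.2))))
  | Sscale r => vset (range (fun x => vpair (f x) (f (r *: x))))
  end.

(* k is the L_R-structure (A, I), where A is the set of the f x and I is the
   function on L_R interpreting each symbol, obtained by transporting the module
   structure of M along the injection f. *)
Definition codes (k : V) : Prop :=
  [/\ injective f, exists A, elts A = range f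
    & k = vpair (vset (range f))
                (vset (range (fun s => vpair (sym L s) (interp s))))].

End Coding.

(* Every module structure on the elements of a set is coded in V; this also fixes
   the universe of V below that of the carriers of modules. *)
Lemma codes_val (R : pzRingType) (L : signature R) (A : V)
    (c : GRing.Lmodule.axioms_ R {x : V | x ∈ A}) :
  exists k, codes L (fun x : GRing.Lmodule.Pack c => sval x) k.
Proof.
eexists; split => //; last by exists A; apply/seteqP; split;
  [move=> x xA; exists (exist _ x xA) | move=> _ [[x xA] _ <-]].
by move=> [x p] [y q] /= e; subst y; rewrite (Prop_irrelevance p q).
Qed.

Section SubQuotient.
Variables (R : pzRingType) (M : lmodType R) (S : submodClosed M).

Definition submodule : Type := {x : M | x \in S}.
HB.instance Definition _ := Choice.on submodule.
HB.instance Definition _ := SubType.on submodule.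
HB.instance Definition _ := [SubChoice_isSubLmodule of submodule by <:].

Definition subgroup_pred : {pred M} := fun x => x \in S.
HB.instance Definition _ := GRing.isZmodClosed.Build M subgroup_pred
  (GRing.submod_closedB (submodClosedP S)).

Definition quotmodule : Type := Quotient.quot subgroup_pred.
HB.instance Definition _ := GRing.Zmodule.on quotmodule.
HB.instance Definition _ := EqQuotient.on quotmodule.

Definition quot_scale (r : R) : quotmodule -> quotmodule :=
  lift_op1 quotmodule ( *:%R r).

Lemma pi_quotE x y :
  (\pi_quotmodule x = \pi_quotmodule y) <-> x - y \in S.
Proof.
rewrite -[x - y \in S]/(Quotient.equiv subgroup_pred x y).
by split=> [/eqmodP | h] //; apply/eqmodP.
Qed.

Lemma pi_quot_scale r x :
  \pi_quotmodule (r *: x) = quot_scale r (\pi_quotmodule x).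
Proof.
rewrite /quot_scale; unlock; apply/pi_quotE.
by rewrite -scalerBr rpredZ //; apply/pi_quotE; rewrite reprK.
Qed.

Lemma pi_quot_add x y :
  \pi_quotmodule (x + y) = \pi_quotmodule x + \pi_quotmodule y.
Proof. by rewrite !piE. Qed.

Lemma quot_scaleA a b x : quot_scale a (quot_scale b x) = quot_scale (a * b) x.
Proof. by rewrite -[x]reprK -!pi_quot_scale scalerA. Qed.

Lemma quot_scale1 : left_id 1 quot_scale.
Proof. by move=> x; rewrite -[x]reprK -pi_quot_scale scale1r. Qed.

Lemma quot_scaleDr : right_distributive quot_scale +%R.
Proof.
move=> a x y; rewrite -[x]reprK -[y]reprK.
by rewrite -pi_quot_add -!pi_quot_scale -pi_quot_add scalerDr.
Qed.

Lemma quot_scaleDl x : {morph quot_scale^~ x : a b / a + b}.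
Proof.
by move=> a b; rewrite -[x]reprK -!pi_quot_scale -pi_quot_add scalerDl.
Qed.

HB.instance Definition _ := GRing.Zmodule_isLmodule.Build R quotmodule
  quot_scaleA quot_scale1 quot_scaleDr quot_scaleDl.

End SubQuotient.

Section Product.
Variables (R : pzRingType) (I : Type) (Q : I -> lmodType R).

Definition product : Type := forall i, Q i.
HB.instance Definition _ := gen_eqMixin product.
HB.instance Definition _ := gen_choiceMixin product.

Definition product_zero : product := fun _ => 0.
Definition product_opp (x : product) : product := fun i => - x i.
Definition product_add (x y : product) : product := fun i => x i + y i.
Definition product_scale (r : R) (x : product) : product := fun i => r *: x i.

Lemma product_addA : associative product_add.
Proof. by move=> x y z; apply: functional_extensionality_dep => i; apply: addrA. Qed.
Lemma product_addC : commutative product_add.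
Proof. by move=> x y; apply: functional_extensionality_dep => i; apply: addrC. Qed.
Lemma product_add0 : left_id product_zero product_add.
Proof. by move=> x; apply: functional_extensionality_dep => i; apply: add0r. Qed.
Lemma product_addN : left_inverse product_zero product_opp product_add.
Proof. by move=> x; apply: functional_extensionality_dep => i; apply: addNr. Qed.

HB.instance Definition _ := GRing.isZmodule.Build product
  product_addA product_addC product_add0 product_addN.

Lemma product_scaleA a b x :
  product_scale a (product_scale b x) = product_scale (a * b) x.
Proof. by apply: functional_extensionality_dep => i; apply: scalerA. Qed.
Lemma product_scale1 : left_id 1 product_scale.
Proof. by move=> x; apply: functional_extensionality_dep => i; apply: scale1r. Qed.
Lemma product_scaleDr : right_distributive product_scale +%R.
Proof. by move=> a x y; apply: functional_extensionality_dep => i; apply: scalerDr. Qed.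
Lemma product_scaleDl x : {morph product_scale^~ x : a b / a + b}.
Proof. by move=> a b; apply: functional_extensionality_dep => i; apply: scalerDl. Qed.

HB.instance Definition _ := GRing.Zmodule_isLmodule.Build R product
  product_scaleA product_scale1 product_scaleDr product_scaleDl.

End Product.

(* A right R-module is an lmodType over the converse ring R^c; its right action
   q . r is r *: q. *)
Section Tensor.
Variables (R : pzRingType) (Q : lmodType R^c) (M : lmodType R).

(* The subgroup of the free abelian group on Q * M generated by the bilinearity
   and balancing relations. *)
Inductive tensor_rel : {freeg (Q * M)} -> Prop :=
  | tensor_rel0 : tensor_rel 0
  | tensor_relB x y : tensor_rel x -> tensor_rel y -> tensor_rel (x - y)
  | tensor_relDl q q' m :
      tensor_rel (<< (q + q', m) >> - << (q, m) >> - << (q', m) >>)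
  | tensor_relDr q m m' :
      tensor_rel (<< (q, m + m') >> - << (q, m) >> - << (q, m') >>)
  | tensor_relZ (r : R) q m :
      tensor_rel (<< ((r : R^c) *: q, m) >> - << (q, r *: m) >>).

Definition tensor_relb : {pred {freeg (Q * M)}} := fun x => `[< tensor_rel x >].

Lemma tensor_relb_closed : zmod_closed tensor_relb.
Proof.
split; first by apply/asboolP; apply: tensor_rel0.
by move=> x y /asboolP hx /asboolP hy; apply/asboolP; apply: tensor_relB.
Qed.
HB.instance Definition _ :=
  GRing.isZmodClosed.Build {freeg (Q * M)} tensor_relb tensor_relb_closed.

Definition tensor : Type := Quotient.quot tensor_relb.
HB.instance Definition _ := GRing.Zmodule.on tensor.
HB.instance Definition _ := EqQuotient.on tensor.

Definition tens (q : Q) (m : M) : tensor := \pi_tensor << (q, m) >>.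

Lemma pi_tensorB (x y : {freeg (Q * M)}) :
  \pi_tensor (x - y) = \pi_tensor x - \pi_tensor y.
Proof. by rewrite !piE. Qed.

Lemma pi_tensorE (x y : {freeg (Q * M)}) :
  (\pi_tensor x = \pi_tensor y) <-> tensor_rel (x - y).
Proof.
rewrite -[tensor_rel _]asboolE.
rewrite -[`[< _ >]]/(Quotient.equiv tensor_relb x y).
by split=> [/eqmodP | h] //; apply/eqmodP.
Qed.

Definition balanced (A : zmodType) (B : Q -> M -> A) : Prop :=
  [/\ forall q q' m, B (q + q') m = B q m + B q' m,
      forall q m m', B q (m + m') = B q m + B q m'
    & forall (r : R) q m, B ((r : R^c) *: q) m = B q (r *: m)].

Lemma tens_balanced : balanced tens.
Proof.
split.
- move=> q q' m; apply/eqP; rewrite -subr_eq -subr_eq0 -!pi_tensorB.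
  apply/eqP; rewrite -[0](subrr (tens q m)) -pi_tensorB subrr.
  by apply/pi_tensorE; rewrite subr0 addrAC; apply: tensor_relDl.
- move=> q m m'; apply/eqP; rewrite -subr_eq -subr_eq0 -!pi_tensorB.
  apply/eqP; rewrite -[0](subrr (tens q m)) -pi_tensorB subrr.
  by apply/pi_tensorE; rewrite subr0 addrAC; apply: tensor_relDr.
- by move=> r q m; apply/pi_tensorE; apply: tensor_relZ.
Qed.

Definition free_lift (A : zmodType) (B : Q -> M -> A) (x : {freeg (Q * M)}) : A :=
  fglift (fun z : Q * M => B z.1 z.2 : zmodule A) x.

Definition tensor_lift (A : zmodType) (B : Q -> M -> A) (t : tensor) : A :=
  free_lift B (repr t).

Lemma free_liftB (A : zmodType) (B : Q -> M -> A) x y :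
  free_lift B (x - y) = free_lift B x - free_lift B y.
Proof. exact: (@lift_is_additive int _ (zmodule A)). Qed.

Lemma free_liftU (A : zmodType) (B : Q -> M -> A) q m :
  free_lift B << (q, m) >> = B q m.
Proof. by rewrite /free_lift liftU scale1r. Qed.

Lemma free_lift_pi (A : zmodType) (B : Q -> M -> A) : balanced B ->
  forall x, tensor_lift B (\pi_tensor x) = free_lift B x.
Proof.
move=> [hl hr hz] x; apply/eqP; rewrite -subr_eq0 -free_liftB; apply/eqP.
have : tensor_rel (repr (\pi_tensor x) - x) by apply/pi_tensorE; rewrite reprK.
elim=> [|y z _ yE _ zE|q q' m|q m m'|r q m].
- by rewrite -[X in free_lift _ X](subrr 0) free_liftB subrr.
- by rewrite free_liftB yE zE subrr.
- by rewrite !free_liftB !free_liftU hl addrAC addrK subrr.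
- by rewrite !free_liftB !free_liftU hr addrAC addrK subrr.
- by rewrite free_liftB !free_liftU hz subrr.
Qed.

Lemma tensor_lift_tens (A : zmodType) (B : Q -> M -> A) : balanced B ->
  forall q m, tensor_lift B (tens q m) = B q m.
Proof. by move=> hB q m; rewrite free_lift_pi // free_liftU. Qed.

Lemma tensor_liftB (A : zmodType) (B : Q -> M -> A) : balanced B ->
  {morph tensor_lift B : t u / t - u}.
Proof.
move=> hB t u; rewrite -[t in LHS]reprK -[u in LHS]reprK -pi_tensorB.
by rewrite free_lift_pi // free_liftB.
Qed.

End Tensor.

Definition tensor_map (R : pzRingType) (M : lmodType R) (Q Q' : lmodType R^c)
    (g : Q -> Q') : tensor Q M -> tensor Q' M :=
  tensor_lift (fun q m => tens (g q) m).

Lemma tensor_map_balanced (R : pzRingType) (M : lmodType R)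
    (Q Q' : lmodType R^c) (g : {linear Q -> Q'}) :
  balanced (fun q (m : M) => tens (g q) m).
Proof.
have [hl hr hz] := tens_balanced Q' M.
split=> [q q' m|q m m'|r q m].
- by rewrite raddfD hl.
- exact: hr.
- by rewrite linearZ hz.
Qed.

Lemma tensor_map_tens (R : pzRingType) (M : lmodType R) (Q Q' : lmodType R^c)
    (g : {linear Q -> Q'}) (q : Q) (m : M) :
  tensor_map g (tens q m) = tens (g q) m.
Proof. exact/tensor_lift_tens/tensor_map_balanced. Qed.

(* Flatness and the Mittag-Leffler condition are tested on the modules and
   families that are sets, that is, up to isomorphism, elements of V. *)
Definition flat (R : pzRingType) (M : lmodType R) : Prop :=
  forall (Q Q' : lmodType R^c) (g : {linear Q -> Q'}),
    small Q -> small Q' -> injective g -> injective (tensor_map (M := M) g).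

Definition prod_tensor_map (R : pzRingType) (M : lmodType R) (I : Type)
    (Q : I -> lmodType R^c) (t : tensor (product Q) M) (i : I) :
    tensor (Q i) M :=
  tensor_map (fun q : product Q => q i) t.

Lemma prod_tensor_map_tens (R : pzRingType) (M : lmodType R) (I : Type)
    (Q : I -> lmodType R^c) (q : product Q) (m : M) (i : I) :
  prod_tensor_map (tens q m) i = tens (q i) m.
Proof.
have [hl hr hz] := tens_balanced (Q i) M.
apply: (@tensor_lift_tens _ _ _ _ (fun (p : product Q) x => tens (p i) x)).
split=> [p p' x|p x y|r p x].
- by rewrite -hl.
- exact: hr.
- by rewrite -hz.
Qed.

Definition mittag_leffler (R : pzRingType) (M : lmodType R) : Prop :=
  forall (I : Type) (Q : I -> lmodType R^c),
    small I -> (forall i, small (Q i)) ->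
    injective (@prod_tensor_map R M I Q).

Definition flat_mittag_leffler (R : pzRingType) (M : lmodType R) : Prop :=
  flat M /\ mittag_leffler M.

(* The code k of M stands for M as an element of the universe; the intersection
   of N with M consists of those x in M whose copy f x lies in N. *)
Definition kaplansky_property (R : pzRingType) (L : signature R)
    (K : lmodType R -> Prop) (G : set V) : Prop :=
  forall N, G N ->
  forall (M : lmodType R) (f : M -> V) (k : V),
    codes L f k -> k ∈ N -> K M ->
    exists S : submodClosed M,
      [/\ forall x, x \in S <-> f x ∈ N, K (submodule S) & K (quotmodule S)].

Definition uniformly_stationary_kaplansky (R : pzRingType) (L : signature R)
    (lam : V) (K : lmodType R -> Prop) : Prop :=
  exists G : set V, stationary lam G /\ kaplansky_property L K G.

Definition closed_appropriate R (L : signature R) (kappa lam : V) : set V :=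
  [set N | [/\ card_lt (elts N) (elts lam), appropriate L N
             & lt_closed kappa N]].

(* Main.v *)
Require Import Defs.
From HB Require Import structures.
From mathcomp Require Import all_boot all_order all_algebra.
From mathcomp Require Import generic_quotient ring_quotient.
From mathcomp Require Import boolp wochoice classical_sets functions cardinality.
From mathcomp.multinomials Require Import freeg.

(** Why the theorem is true. Write nu for |R| + aleph_0, carried by the type
    R + nat, so that kappa is the successor of nu.

    Stationarity is a closing-off argument. Starting from P and the symbols of
    L_R, one closes under Skolem functions of all formulas, under the formation
    of the range of every function from R + nat, and under the elements of those
    members that lie in lam. This is done in kappa stages [stage]. Each stage
    has size less than lam because lam is regular and mu^nu < lam for mu < lam
    [stage_lt], and kappa stages suffice because kappa is regular
    [closure_exists].

    For the Kaplansky property, flat Mittag-Leffler modules are first described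
    without tensor products [flat_mittag_leffler_factorizable]: every finite
    tuple m of M can be written m = A y, with A a matrix over R, such that
    D m = B z always implies D A = B C for some C. Flatness gives the equational
    criterion, by testing on a submodule of a free module [flat_vanish]; the
    Mittag-Leffler condition, tested on the product of the quotients of R^n by
    all the submodules over which m factors, gives a least such submodule.
    Conversely a vanishing sum of tensors involves finitely many linear relations
    in M [tensor_rel_finite], which are solved simultaneously [tensor_vanish].

    Let now N be a closed elementary structure that contains a code of M, and let
    S be the submodule of the elements of M lying in N. Set theory enters through
    one fact only [retraction]: every submodule X of M of size at most nu admits
    a linear map theta : X -> S that is the identity on the intersection of X and
    S. Indeed the addition table, the multiplication table and the constants of X,
    written with names taken from N, are subsets of N of size at most nu, hence
    elements of N, and the existence of a map that respects them is a Sigma_1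
    statement.

    Applying theta to m = A y gives the factorization property for S. For M / S,
    take a tuple m of M. Each m + s with s in S has a minimal matrix; these
    matrices number at most nu, so one may choose for each occurring matrix A some
    s_A and y_A with m + s_A = A y_A and put all these elements in X. With
    m' = theta(m) one has m' + s_A = A theta(y_A), so m - m' = A (y_A - theta(y_A))
    for every A: the minimal matrix of m - m' divides all the others
    [least_minimal_factor]. It is then minimal for the image of m in M / S, since
    S is pure in M [retracts_pure]. *)

Set Implicit Arguments.
Unset Strict Implicit.
Unset Printing Implicit Defensive.

Import GRing.Theory.
Local Open Scope classical_set_scope.
Local Open Scope card_scope.
Local Open Scope quotient_scope.

(** * Cardinal arithmetic *)

Lemma card_le_fun T U (A : set T) (B : set U) (f : T -> U) :
  (forall x, A x -> B (f x)) ->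
  (forall x y, A x -> A y -> f x = f y -> x = y) -> A #<= B.
Proof.
move=> fAB finj; have [g] : $|{injfun A >-> B}|; last exact: inj_card_le g.
apply/injfunPex; exists f => // x y; rewrite !inE; exact: finj.
Qed.

Lemma card_le_inj T U (f : T -> U) : injective f -> [set: T] #<= [set: U].
Proof. by move=> fI; apply: (@card_le_fun _ _ _ _ f) => // x y _ _ /fI. Qed.

Lemma card_le_rel T U (A : set T) (B : set U) (G : T -> U -> Prop) :
  (forall x, A x -> exists2 y, B y & G x y) ->
  (forall x x' y, A x -> A x' -> G x y -> G x' y -> x = x') -> A #<= B.
Proof.
move=> Gt Gi; have [-> //|/set0P[x0 Ax0]] := eqVneq A set0.
have [y0 _ _] := Gt _ Ax0.
have /choice[f fP] x : exists y, A x -> B y /\ G x y.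
  by have [Ax|nAx] := pselect (A x); [have [y ? ?] := Gt _ Ax; exists y|exists y0].
apply: (@card_le_fun _ _ _ _ f) => [x /fP[]//|x x' Ax Ax' e].
by apply: (Gi _ _ (f x)) => //; [have [] := fP _ Ax|rewrite e; have [] := fP _ Ax'].
Qed.

Lemma card_le_ex T U (A : set T) (B : set U) : U -> A #<= B ->
  exists f : T -> U, (forall x, A x -> B (f x)) /\
     forall x y, A x -> A y -> f x = f y -> x = y.
Proof.
move=> u0 /card_leP[g].
pose f x := if pselect (A x) is left h then sval (g (exist _ x (mem_set h))) else u0.
exists f; split=> [x Ax|x y Ax Ay].
  by rewrite /f; case: pselect => // h; apply: set_mem; apply: (svalP (g _)).
rewrite /f; case: pselect => // hx; case: pselect => // hy e.
have /(@inj _ _ _ g) : g (exist _ x (mem_set hx)) = g (exist _ y (mem_set hy)).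
  exact: val_inj.
by rewrite !inE => /(_ I I) [].
Qed.

Lemma card_le_exT T U : [set: T] #<= [set: U] -> exists f : T -> U, injective f.
Proof.
move=> TU; have [[u _]|nU] := pselect (exists u : U, True).
  by have [f [_ fI]] := card_le_ex u TU; exists f => x y; apply: fI.
have nT (t : T) : False.
  by have /card_leP[g] := TU; apply: nU; exists (sval (g (exist _ t (mem_set I)))).
by exists (fun t => match nT t with end) => x; case: (nT x).
Qed.

(** A maximal injective partial map is total on one side. *)
Lemma card_le_total T U (A : set T) (B : set U) : A #<= B \/ B #<= A.
Proof.
pose P (G : set (T * U)) := [/\ forall z, G z -> A z.1 /\ B z.2,
   forall x y y', G (x, y) -> G (x, y') -> y = y'
 & forall x x' y, G (x, y) -> G (x', y) -> x = x'].
have [F FP Ftot|G [[GAB Gf Gi] Gmax]] := @Zorn_bigcup _ P.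
  have two a b : (\bigcup_(X in F) X) a -> (\bigcup_(X in F) X) b ->
    exists X, [/\ F X, X a & X b].
    move=> [X FX Xa] [Y FY Yb].
    by have [XY|YX] := Ftot _ _ FX FY; [exists Y|exists X]; split=> //;
       [apply: XY|apply: YX].
  split.
  - by move=> z [X /FP[h _ _]] /h.
  - by move=> x y y' /two h /h[X [/FP[_ h' _]]]; apply: h'.
  - by move=> x x' y /two h /h[X [/FP[_ _ h']]]; apply: h'.
have [hA|/existsNP[x /not_implyP[Ax nx]]] :=
  pselect (forall x, A x -> exists y, G (x, y)).
  left; apply: (@card_le_rel _ _ _ _ (fun x y => G (x, y))) => [x /hA[y Gxy]|x x' y _ _].
    by exists y => //; have [] := GAB _ Gxy.
  exact: Gi.
have [hB|/existsNP[y /not_implyP[By ny]]] :=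
  pselect (forall y, B y -> exists x, G (x, y)).
  right; apply: (@card_le_rel _ _ _ _ (fun y x => G (x, y))) => [y /hB[x' Gxy]|y y' x' _ _].
    by exists x' => //; have [] := GAB _ Gxy.
  exact: Gf.
have /Gmax[] : G `<` G `|` [set (x, y)].
  by split; [left|move=> /(_ (x, y) (or_intror erefl)) Gxy; apply: nx; exists y].
split.
- by move=> z [/GAB//|->].
- move=> x1 y1 y2 [h1|[e1 e2]] [h2|[e3 e4]]; subst=> //; first exact: Gf h1 h2.
  + by case: nx; exists y1.
  + by case: nx; exists y2.
- move=> x1 x2 y1 [h1|[e1 e2]] [h2|[e3 e4]]; subst=> //; first exact: Gi h1 h2.
  + by case: ny; exists x1.
  + by case: ny; exists x2.
Qed.

Lemma card_ltE T U (A : set T) (B : set U) : card_lt A B <-> ~ (B #<= A).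
Proof. by split=> [[]//|h]; split=> //; case: (card_le_total A B). Qed.

Lemma card_le_lt_trans T U W (A : set T) (B : set U) (C : set W) :
  A #<= B -> card_lt B C -> card_lt A C.
Proof.
move=> AB /card_ltE BC; apply/card_ltE => CA; apply: BC; exact: card_le_trans CA AB.
Qed.

Lemma cantor T : ~ ([set: T -> bool] #<= [set: T]).
Proof.
move=> /card_le_exT[f fI].
pose d x := `[< exists2 g : T -> bool, f g = x & ~~ g x >].
have [dd|ndd] := boolP (d (f d)).
  by move: (dd) => /asboolP[g /fI ->]; rewrite dd.
by move: (ndd) => /asboolP[]; exists d.
Qed.

Section Square.
Variable T : Type.
Implicit Types (F : set (T * T * T)).

Let field F : set T := [set x | exists z, F ((x, x), z)].

Let pairing F := [/\
  forall x y z, F ((x, y), z) -> [/\ field F x, field F y & field F z],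
  forall p z z', F (p, z) -> F (p, z') -> z = z',
  forall p p' z, F (p, z) -> F (p', z) -> p = p'
& forall x y, field F x -> field F y -> exists z, F ((x, y), z)].

Let pairing_bigcup (C : set (set (T * T * T))) :
  C `<=` pairing -> total_on C subset -> pairing (\bigcup_(X in C) X).
Proof.
move=> CP Ctot; set W := \bigcup_(X in C) X.
have two a b : W a -> W b -> exists X, [/\ C X, X a & X b].
  move=> [X CX Xa] [Y CY Yb].
  by have [XY|YX] := Ctot _ _ CX CY; [exists Y|exists X]; split=> //;
     [apply: XY|apply: YX].
have fieldW X x : C X -> field X x -> field W x.
  by move=> CX [z Xz]; exists z, X.
split.
- move=> x y z [X CX Xxyz]; have [h _ _ _] := CP _ CX.
  by have [hx hy hz] := h _ _ _ Xxyz; split; apply: fieldW CX _.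
- by move=> p z z' /two h /h[X [/CP[_ h' _ _]]]; apply: h'.
- by move=> p p' z /two h /h[X [/CP[_ _ h' _]]]; apply: h'.
- move=> x y [z /two h] [z' /h [X [CX Xx Xy]]]; have [_ _ _ h'] := CP _ CX.
  by have [w Xw] := h' x y (ex_intro _ z Xx) (ex_intro _ z' Xy); exists w, X.
Qed.

(** Zorn's lemma on injective pairings A * A -> A with A infinite: if the
    complement of A were at least as large as A, a copy B of A inside it would
    give room for the new pairs of A + B, since these embed into A. *)
Lemma card_square_le : [set: nat] #<= [set: T] -> [set: T * T] #<= [set: T].
Proof.
move=> natT; have [u uI] := card_le_exT natT; pose t0 := u 0%N.
have [c cI] : exists c : nat * nat -> nat, injective c.
  by apply: card_le_exT; have := card_nat2; rewrite card_eq_le => /andP[].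
pose F0 : set (T * T * T) := [set w | exists m n, w = ((u m, u n), u (c (m, n)))].
have F0field x : field F0 x <-> exists n, x = u n.
  split=> [[z [m [n [-> _ _]]]]|[n ->]]; first by exists m.
  by exists (u (c (n, n))), n, n.
have F0P : pairing F0.
  split.
  - by move=> x y z [m [n [-> -> ->]]]; split; apply/F0field; eexists.
  - move=> p z z' [m [n [-> ->]]] [m' [n' [/uI e1 /uI e2 ->]]].
    by rewrite e1 e2.
  - move=> p p' z [m [n [-> ->]]] [m' [n' [-> /uI /cI [-> ->]]]] //.
  - by move=> x y /F0field[m ->] /F0field[n ->]; exists (u (c (m, n))), m, n.
have [C CP Ctot|F [FP Fmax]] := @Zorn_bigcup _ [set F | pairing (F0 `|` F)].
  have [->|/set0P[X0 CX0]] := eqVneq C set0; first by rewrite /= bigcup_set0 setU0.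
  pose C' := [set F0 `|` X | X in C].
  rewrite /=; have -> : F0 `|` \bigcup_(X in C) X = \bigcup_(X in C') X.
    rewrite bigcup_image; apply/seteqP; split=> [w [F0w|[X CX Xw]]|w [X CX [F0w|Xw]]].
    - by exists X0 => //; left.
    - by exists X => //; right.
    - by left.
    - by right; exists X.
  apply: pairing_bigcup => [_ [X CX <-]|_ _ [X CX <-] [Y CY <-]]; first exact: CP.
  by have [XY|YX] := Ctot _ _ CX CY; [left|right]; apply: setUS.
set G := F0 `|` F in FP; have {}Fmax G' : G `<` G' -> ~ pairing G'.
  move=> [GG' nG'] G'P; apply: (Fmax G').
    split=> [w Fw|G'F]; first by apply: GG'; right.
    by apply: nG' => w /G'F; right.
  by rewrite /= (_ : _ `|` _ = G') // setUidr // => w F0w; apply: GG'; left.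
have [Gfld Gfun Ginj Gtot] := FP.
set A := field G in Gfld Gtot *.
have Au n : A (u n).
  have /F0field[z F0z] : exists m, u n = u m by exists n.
  by exists z; left.
have /choice[f fP] p : exists z, A p.1 -> A p.2 -> G (p, z).
  case: p => x y; have [Axy|nAxy] := pselect (A x /\ A y).
    by have [z Gz] := Gtot _ _ Axy.1 Axy.2; exists z.
  by exists t0 => ? ?; case: nAxy.
have Af p : A p.1 -> A p.2 -> A (f p).
  by case: p => x y Ax Ay; have /Gfld[] := fP (x, y) Ax Ay.
have fI p q : A p.1 -> A p.2 -> A q.1 -> A q.2 -> f p = f q -> p = q.
  move=> p1 p2 q1 q2 e; apply: (Ginj _ _ (f p)); first exact: fP.
  by rewrite e; exact: fP.
have Af2 a b : A a -> A b -> A (f (a, b)) by move=> ? ?; exact: (Af).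
have fI2 a b a' b' : A a -> A b -> A a' -> A b' -> f (a, b) = f (a', b') ->
    a = a' /\ b = b'.
  by move=> ? ? ? ? e; have [] : (a, b) = (a', b') by exact: fI.
have [Ale|nAle] := card_le_total A (~` A).
  have [g [gA gI]] := card_le_ex t0 Ale.
  pose B := g @` A.
  have nAB x : B x -> ~ A x by move=> [y Ay <-]; apply: gA.
  have /choice[h hP] x : exists y, B x -> A y /\ g y = x.
    by have [[y Ay <-]|nB] := pselect (B x); [exists y|exists t0].
  pose r x := if pselect (A x) then x else h x.
  (* r identifies B with A; the tag tells an element of A from its copy in B *)
  pose tag x : nat := if pselect (A x) then 0%N else 1%N.
  pose AB := A `|` B.
  have rA x : AB x -> A (r x).
    by rewrite /r; case: pselect => //= nA [//|/hP[]].
  have rI x y : AB x -> AB y -> r x = r y -> tag x = tag y -> x = y.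
    rewrite /r /tag; case: pselect => //= nx; case: pselect => //= ny.
    move=> [//|Bx] [//|By] e _.
    by have [_ <-] := hP _ Bx; have [_ <-] := hP _ By; rewrite e.
  pose k p := g (f (f (r p.1, r p.2), u (c (tag p.1, tag p.2)))).
  have kB p : AB p.1 -> AB p.2 -> B (k p).
    by move=> h1 h2; apply: imageP; exact/Af2/Au/Af2/rA/h2/rA/h1.
  have kI p q : AB p.1 -> AB p.2 -> AB q.1 -> AB q.2 -> k p = k q -> p = q.
    case: p q => [x y] [x' y'] /= hx hy hx' hy'.
    have rx := rA _ hx; have ry := rA _ hy; have rx' := rA _ hx'; have ry' := rA _ hy'.
    move=> /(gI _ _ (Af2 _ _ (Af2 _ _ rx ry) (Au _)) (Af2 _ _ (Af2 _ _ rx' ry') (Au _))).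
    move=> /(fI2 _ _ _ _ (Af2 _ _ rx ry) (Au _) (Af2 _ _ rx' ry') (Au _)) [].
    move=> /(fI2 _ _ _ _ rx ry rx' ry') [e1 e2] /uI /cI [e3 e4].
    by rewrite (rI x x') // (rI y y').
  pose new : set (T * T * T) :=
    [set w | [/\ AB w.1.1, AB w.1.2, ~ (A w.1.1 /\ A w.1.2) & w.2 = k w.1]].
  have fld x : field (G `|` new) x <-> AB x.
    split=> [[z [Gz|[]//]]|[[z Gz]|Bx]]; first by left; exists z.
      by exists z; left.
    by exists (k (x, x)); right; split; [right|right|move=> [/nAB]|].
  exfalso; apply: (Fmax (G `|` new)).
    split; first by move=> w; left.
    have Bx : B (g (u 0%N)) by exists (u 0%N).
    have : field (G `|` new) (g (u 0%N)) by apply/fld; right.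
    by move=> [z Gz] /(_ _ Gz) Gz'; apply: (nAB _ Bx); exists z.
  split.
  - move=> x y z [/Gfld[hx hy hz]|[/= hx hy _ ->]].
      by split; apply/fld; left.
    by split; apply/fld => //; right; exact: kB.
  - move=> [x y] z z' [w|[/= _ _ w ->]] [w'|[/= _ _ w' ->]] //; first exact: Gfun w w'.
      by case: w'; have [] := Gfld _ _ _ w.
    by case: w; have [] := Gfld _ _ _ w'.
  - move=> [x y] [x' y'] z [w|[/= h1 h2 _ ez]] [w'|[/= h3 h4 _ ez']].
    + exact: Ginj w w'.
    + by have [_ _ Az] := Gfld _ _ _ w; case: (nAB z); rewrite // ez'; exact: kB.
    + by have [_ _ Az] := Gfld _ _ _ w'; case: (nAB z); rewrite // ez; exact: kB.
    + by apply: kI => //; rewrite -ez -ez'.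
  - move=> x y /fld hx /fld hy.
    have [[/= w w']|n] := pselect (A x /\ A y); last by exists (k (x, y)); right.
    by have [z Gz] := Gtot _ _ w w'; exists z; left.
(* now the complement of A embeds into A, hence so does T, with the help of a tag *)
have [g [gA gI]] := card_le_ex t0 nAle.
pose r x := if pselect (A x) then (x, u 0%N) else (g x, u 1%N).
have rA x : A (r x).1 /\ A (r x).2.
  by rewrite /r; case: pselect => //= nA; split=> //; apply: gA.
have rI : injective r.
  move=> x y; rewrite /r; case: pselect => nx; case: pselect => ny // [] //.
    by move=> _ /uI.
    by move=> _ /uI.
  exact: gI.
pose s x := f (r x).
have sA x : A (s x) by have [] := rA x; apply: (Af).
have sI : injective s.
  by move=> x y /fI e; apply: rI; have [? ?] := rA x; have [? ?] := rA y; apply: e.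
apply: (card_le_inj (f := fun p => f (s p.1, s p.2))) => -[x y] [x' y'] /fI /= e.
by have [/sI -> /sI ->] := e (sA _) (sA _) (sA _) (sA _).
Qed.

End Square.

Section Infinite.
Variable T : Type.
Hypothesis natT : [set: nat] #<= [set: T].

Lemma infinite_inhabited : exists t : T, True.
Proof.
by have [u _] := card_le_exT natT; exists (u 0%N).
Qed.

Lemma card_le_squareP : exists p : T -> T -> T,
  forall x y x' y', p x y = p x' y' -> x = x' /\ y = y'.
Proof.
have [f fI] := card_le_exT (card_square_le natT).
by exists (fun x y => f (x, y)) => x y x' y' /fI [].
Qed.

Lemma card_le_nat_inj : exists u : nat -> T, injective u.
Proof. exact: card_le_exT natT. Qed.

(** Iterated pairing is injective on sequences of a given length. *)
Lemma card_seq_le : [set: seq T] #<= [set: T].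
Proof.
have [p pI] := card_le_squareP; have [u uI] := card_le_nat_inj.
pose enc := foldr p (u 0%N).
apply: (card_le_inj (f := fun s => p (u (size s)) (enc s))) => s s'.
move=> /pI [/uI]; elim: s s' => [|x s IH] [|y s'] //= [/IH h] /pI[-> /h ->] //.
Qed.

Lemma card_bigcup_le I U (D : set I) (F : I -> set U) :
  D #<= [set: T] -> (forall i, D i -> F i #<= [set: T]) ->
  \bigcup_(i in D) F i #<= [set: T].
Proof.
have [t0 _] := infinite_inhabited; have [p pI] := card_le_squareP.
move=> /(card_le_ex t0)[d [_ dI]] DF.
have /choice[h hP] i : exists h : U -> T, D i -> forall x y, F i x -> F i y -> h x = h y -> x = y.
  have [Di|nD] := pselect (D i); last by exists (fun=> t0).
  by have [h [_ hI]] := card_le_ex t0 (DF _ Di); exists h.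
apply: (@card_le_rel _ _ _ _ (fun x y => exists i, [/\ D i, F i x & y = p (d i) (h i x)])).
  by move=> x [i Di Fx]; exists (p (d i) (h i x)) => //; exists i.
move=> x x' y _ _ [i [Di Fx ->]] [j [Dj Fx' /pI[/dI e]]].
by have {}e := e Di Dj; subst j; apply: hP.
Qed.

Lemma card_setU_le U (A B : set U) :
  A #<= [set: T] -> B #<= [set: T] -> A `|` B #<= [set: T].
Proof.
move=> AT BT; have -> : A `|` B = \bigcup_(b in [set: bool]) (if b then A else B).
  by apply/seteqP; split=> [z [h|h]|z [[] _ h]]; [exists true|exists false|left|right].
apply: card_bigcup_le => [|[] _ //].
by apply: card_le_trans natT; apply: (@card_le_inj _ _ nat_of_bool) => -[] [].
Qed.

End Infinite.

Lemma card_fun_le T U T' U' : U' -> [set: T] #<= [set: T'] -> [set: U] #<= [set: U'] ->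
  [set: T -> U] #<= [set: T' -> U'].
Proof.
move=> u0 TT UU; have [g gI] := card_le_exT UU; have [f fI] := card_le_exT TT.
have /choice[h hP] (k : T -> U) : exists k' : T' -> U', forall x, k' (f x) = g (k x).
  have /choice[k' k'P] y : exists z, forall x, f x = y -> z = g (k x).
    have [[x <-]|nf] := pselect (exists x, f x = y); last first.
      by exists u0 => x e; case: nf; exists x.
    by exists (g (k x)) => x' /fI ->.
  by exists k' => x; apply: k'P.
by apply: (card_le_inj (f := h)) => k k' e; apply: funext => x; apply: gI; rewrite -!hP e.
Qed.

(** (2^T)^T = 2^(T * T) = 2^T. *)
Lemma card_fun_pow_le T : [set: nat] #<= [set: T] ->
  [set: T -> (T -> bool)] #<= [set: T -> bool].
Proof.
move=> natT; apply: card_le_trans (card_fun_le true (card_square_le natT) (card_lexx _)).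
apply: (card_le_inj (f := fun (g : T -> T -> bool) z => g z.1 z.2)) => g g' e.
by apply: funext => x; apply: funext => y; have := congr1 (@^~ (x, y)) e.
Qed.

(** * Sets, ordinals and successor cardinals in V *)

Lemma elts_index (x : V) : exists (A : Type) (g : A -> V), elts x = range g.
Proof.
rewrite /elts /vmem; case: (repr x) => A f.
exists A, (fun a => \pi_V (f a)); apply/seteqP.
by split=> [y [a ->]|_ [a _ <-]]; [exists a|exists a].
Qed.

Definition vsmall (C : set V) : Prop := exists x, elts x = C.

Lemma vsmall_elts x : vsmall (elts x). Proof. by exists x. Qed.

Lemma vsmall_range (A : Type) (g : A -> V) : vsmall (range g).
Proof. by exists (vsup g); exact: elts_vsup. Qed.

Lemma vsmall_sub C D : vsmall C -> D `<=` C -> vsmall D.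
Proof.
move=> [x <-] DC; have [A [g xg]] := elts_index x.
exists (vsup (fun a : {a | D (g a)} => g (sval a))); rewrite elts_vsup.
apply/seteqP; split=> [_ [[a Da] _ <-]//|y Dy].
by have := DC _ Dy; rewrite xg => -[a _ ay]; subst y; exists (exist _ a Dy).
Qed.

Lemma vsmall_image C (F : V -> V) : vsmall C -> vsmall (F @` C).
Proof.
move=> [x <-]; have [A [g ->]] := elts_index x.
by rewrite image_comp; apply: (vsmall_range (F \o g)).
Qed.

(** Replacement. *)
Lemma card_le_vsmall T (A : set T) (C : set V) : C #<= A -> (exists x, A #<= elts x) ->
  vsmall C.
Proof.
move=> CA [x Ax]; have [f [fx fI]] := card_le_ex vempty (card_le_trans CA Ax).
have /choice[h hP] y : exists z, forall c, C c -> f c = y -> z = c.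
  have [[c [Cc <-]]|n] := pselect (exists c, C c /\ f c = y).
    by exists c => c' Cc' /fI ->.
  by exists vempty => c Cc e; case: n; exists c.
apply: (vsmall_sub (vsmall_image h (vsmall_elts x))) => c Cc.
by exists (f c); [apply: fx|apply: hP].
Qed.

Lemma vsmallU C D : vsmall C -> vsmall D -> vsmall (C `|` D).
Proof.
move=> [x <-] [y <-]; rewrite -bigcup2E.
have [A [g xg]] := elts_index x; have [B [h yh]] := elts_index y.
exists (vsup (fun ab : A + B => match ab with inl a => g a | inr b => h b end)).
rewrite elts_vsup bigcup2E xg yh; apply/seteqP; split.
  by move=> _ [[a|b] _ <-]; [left; exists a|right; exists b].
by move=> _ [[a _ <-]|[b _ <-]]; [exists (inl a)|exists (inr b)].
Qed.

Lemma vsmall1 x : vsmall [set x].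
Proof.
exists (vsup (fun _ : unit => x)); rewrite elts_vsup.
by apply/seteqP; split=> [_ [] //|_ ->]; exists tt.
Qed.

Lemma vsetE C : vsmall C -> elts (vset C) = C.
Proof. by move=> [x /elts_vset]. Qed.

Lemma in_vset C y : vsmall C -> (y ∈ vset C <-> C y).
Proof. by move=> /vsetE {2}<-. Qed.

Lemma in_vset2 x y z : z ∈ vset [set x; y] <-> z = x \/ z = y.
Proof. by apply: in_vset; apply: vsmallU; apply: vsmall1. Qed.

Lemma in_vset1 x z : z ∈ vset [set x] <-> z = x.
Proof. by apply: in_vset; apply: vsmall1. Qed.

Lemma in_vpair x y z : z ∈ vpair x y <-> z = vset [set x] \/ z = vset [set x; y].
Proof. exact: in_vset2. Qed.

Lemma vpair_inj x y x' y' : vpair x y = vpair x' y' -> x = x' /\ y = y'.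
Proof.
move=> e; have ex : x = x'.
  have : vset [set x] ∈ vpair x' y' by rewrite -e; apply/in_vpair; left.
  move=> /in_vpair[h|h]; first by apply/in_vset1; rewrite -h; apply/in_vset1.
  by apply/esym/in_vset1; rewrite h; apply/in_vset2; left.
subst x'; split=> //.
have : vset [set x; y] ∈ vpair x y' by rewrite -e; apply/in_vpair; right.
have : vset [set x; y'] ∈ vpair x y by rewrite e; apply/in_vpair; right.
move=> /in_vpair h /in_vpair h'.
have yx : vset [set x; y] = vset [set x] -> y = x.
  by move=> h1; apply/in_vset1; rewrite -h1; apply/in_vset2; right.
have yx' : vset [set x; y'] = vset [set x] -> y' = x.
  by move=> h1; apply/in_vset1; rewrite -h1; apply/in_vset2; right.
have xy' : vset [set x; y] = vset [set x; y'] -> y = y'.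
  move=> h1; have : y ∈ vset [set x; y'] by rewrite -h1; apply/in_vset2; right.
  move=> /in_vset2[yxE|//]; have : y' ∈ vset [set x; y] by rewrite h1; apply/in_vset2; right.
  by move=> /in_vset2[->|->].
case: h' => [/yx h1|/xy' //]; case: h => [/yx' ->//|/esym/xy' //].
Qed.

Lemma vmem_irr x : ~ x ∈ x.
Proof. by elim/vmem_ind: x => x IH xx; apply: (IH x). Qed.

Lemma vmem_asym x y : x ∈ y -> ~ y ∈ x.
Proof. by elim/vmem_ind: x y => x IH y xy yx; apply: (IH y yx x). Qed.

Lemma vmem_min (C : set V) : C !=set0 -> exists2 x, C x & forall y, y ∈ x -> ~ C y.
Proof.
move=> [x]; elim/vmem_ind: x => x IH Cx.
have [[y yx Cy]|n] := pselect (exists2 y, y ∈ x & C y); first exact: IH Cy.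
by exists x => // y yx Cy; apply: n; exists y.
Qed.

Notation vordinal c := (is_ordinal (elts c)).

Lemma ordinal_mem a b : vordinal a -> b ∈ a -> vordinal b.
Proof.
move=> [atr atot] ba; have ba' := atr _ ba; split.
- move=> x xb y yx; have xa : x ∈ a by apply: ba'.
  have ya : y ∈ a by apply: atr yx.
  have [//|[yb|by_]] := atot _ _ ya ba.
    by subst y; case: (vmem_asym xb yx).
  (* otherwise x, y and b form a membership cycle *)
  exfalso; pose C : set V := [set x; y; b].
  have Cx : C x by left; left.
  have Cmin z : C z -> exists2 w, C w & w ∈ z.
    by move=> [[->|->]|->]; [exists y|exists b|exists x] => //; [left; right|right].
  have [z Cz zmin] := vmem_min (ex_intro _ x Cx); have [w Cw wz] := Cmin _ Cz.
  exact: zmin wz Cw.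
- by move=> x y xb yb; apply: atot; apply: ba'.
Qed.

Lemma ordinal_sub a b : vordinal a -> vordinal b -> elts a `<=` elts b -> a = b \/ a ∈ b.
Proof.
move=> [atr atot] [btr btot] ab.
have [ba|/existsNP[x0 /not_implyP[xb xa]]] := pselect (elts b `<=` elts a).
  by left; apply: elts_inj; apply/seteqP.
right; have [x [{}xb {}xa] xmin] := @vmem_min [set x | x ∈ b /\ ~ x ∈ a] (ex_intro _ x0 (conj xb xa)).
suff <- : x = a by [].
apply: vext => y; split=> [yx|ya].
  by apply: contrapT => nya; apply: (xmin _ yx); split=> //; apply: btr yx.
have [//|[yx|xy]] := btot _ _ (ab _ ya) xb; first by subst y.
by case: xa; apply: atr xy.
Qed.

Lemma ordinal_total a b : vordinal a -> vordinal b -> [\/ a ∈ b, a = b | b ∈ a].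
Proof.
move=> oa ob; have [atr atot] := oa; have [btr btot] := ob.
have [c cE] : vsmall (elts a `&` elts b).
  by apply: (vsmall_sub (vsmall_elts a)) => x [].
have oc : vordinal c.
  rewrite cE; split=> [x [xa xb] y yx|x y [xa xb] [ya yb]]; last exact: atot.
  by split; [apply: atr yx|apply: btr yx].
have ca : elts c `<=` elts a by rewrite cE => x [].
have cb : elts c `<=` elts b by rewrite cE => x [].
have [ea|ina] := ordinal_sub oc oa ca; have [eb|inb] := ordinal_sub oc ob cb.
- by apply: Or32; rewrite -ea -eb.
- by apply: Or31; rewrite -ea.
- by apply: Or33; rewrite -eb.
- case: (@vmem_irr c); have : (elts a `&` elts b) c by [].
  by rewrite -cE.
Qed.

Lemma ordinal_least (C : set V) a : C a -> (forall x, C x -> vordinal x) ->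
  exists2 x, C x & forall y, C y -> x = y \/ x ∈ y.
Proof.
move=> Ca Co; have [x Cx xmin] := vmem_min (ex_intro _ a Ca).
exists x => // y Cy; have [|->|/xmin//] := ordinal_total (Co _ Cx) (Co _ Cy); by auto.
Qed.

Lemma well_order_exists (A : Type) : exists R : rel A, well_order R.
Proof.
by elim/Peq: A => A; have [R Rwo] := well_ordering_principle A; exists R.
Qed.

(** Mostowski collapse of a well-ordering of A. *)
Lemma ordinal_enum (A : Type) : exists m : A -> V, injective m /\ is_ordinal (range m).
Proof.
have [R Rwo] := well_order_exists A.
pose r (b a : A) : Prop := R b a /\ b <> a.
have Rmin (C : set A) : C !=set0 -> exists2 z, C z & forall y, C y -> R z y.
  move=> [x Cx]; have [|z [[zC zlb] _]] := Rwo (mem C); first by exists x; apply/mem_set.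
  by exists z => [|y Cy]; [apply: set_mem|apply: zlb; apply: mem_set].
have Ranti x y : R x y -> R y x -> x = y.
  move=> xy yx; have [|z [_ zu]] := Rwo (mem [set x; y]).
    by exists x; apply: mem_set; left.
  have Rr u : R u u by have [v -> /(_ _ erefl)] := Rmin [set u] (ex_intro _ u erefl).
  rewrite -(zu x) ?(zu y) //; split; try (by apply: mem_set; by [left|right]).
  - by move=> w /set_mem[->|->].
  - by move=> w /set_mem[->|->].
have Rtri x y : [\/ r x y, x = y | r y x].
  have [->|xy] := pselect (x = y); first exact: Or32.
  have [z [->|->] h] := Rmin [set x; y] (ex_intro _ x (or_introl erefl)).
    by apply: Or31; split=> //; apply: h; right.
  by apply: Or33; split; [apply: h; left|apply/nesym].
have rwf : well_founded r.
  move=> x; apply: contrapT => nx.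
  have [z nz zmin] := Rmin [set y | ~ Acc r y] (ex_intro _ x nx).
  apply: nz; constructor => y [yz ne]; apply: contrapT => ny.
  by apply: ne; apply: Ranti => //; apply: zmin.
pose m := Fix rwf (fun=> V) (fun a rec => vsup (fun b : {b | r b a} => rec (sval b) (svalP b))).
have mE a : m a = vsup (fun b : {b | r b a} => m (sval b)).
  rewrite /m Fix_eq // => x f g fg; congr vsup.
  by apply: funext => b; apply: fg.
have in_m y a : y ∈ m a <-> exists2 b, r b a & y = m b.
  rewrite -[y ∈ _]/(elts (m a) y) mE elts_vsup.
  by split=> [[[b ba] _ <-]|[b ba ->]]; [exists b|exists (exist _ b ba)].
have mI : injective m.
  move=> x y e; have [xy|//|yx] := Rtri x y.
    by case: (@vmem_irr (m x)); rewrite {2}e; apply/in_m; exists x.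
  by case: (@vmem_irr (m x)); rewrite {1}e; apply/in_m; exists y.
exists m; split=> //; split=> [_ [a _ <-] y /in_m[b _ ->]|_ _ [a _ <-] [b _ <-]].
  by exists b.
have [ab|->|ba] := Rtri a b; first by left; apply/in_m; exists a.
  by right; left.
by right; right; apply/in_m; exists b.
Qed.

Lemma card_le_void T (A : set void) (B : set T) : A #<= B.
Proof. by apply: (@card_le_fun _ _ _ _ (fun x : void => match x with end)) => -[]. Qed.

(** A copy of A among the indices of x is a type over which trees branch, so
    that the collapse of a well-ordering of it is a set. *)
Lemma ordinal_card T (A : set T) (x : V) : A #<= elts x ->
  exists th, [/\ vordinal th, elts th #<= A & A #<= elts th].
Proof.
move=> Ax; have [B [g xg]] := elts_index x.
have {Ax xg}AB : A #<= [set: B].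
  by apply: card_le_trans Ax _; rewrite xg; exact: card_image_le.
have [[b _]|nB] := pselect (exists b : B, True); last first.
  exists vempty; rewrite elts_vsup; split.
  - by split=> [_ [[]]|_ ? [[]]].
  - exact: card_le_trans (card_image_le _ _) (card_le_void _ _).
  - by apply: card_le_trans AB (card_le_fun (f := fun=> vempty) _ _) => b; case: nB; exists b.
have [i [_ iI]] := card_le_ex b AB.
have [m [mI mo]] := ordinal_enum {b | exists2 t, A t & i t = b}.
exists (vsup m); rewrite elts_vsup; split=> //.
  apply: (@card_le_rel _ _ _ _ (fun y t => exists c, y = m c /\ sval c = i t)).
    by move=> _ [[c [t At tc]] _ <-]; exists t => //; eexists; split; [reflexivity|].
  by move=> _ _ t _ _ [[c hc] [-> /= e]] [[c' hc'] [-> /= e']]; congr m; apply: eq_exist; rewrite e e'.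
apply: (@card_le_rel _ _ _ _ (fun t y => exists c, y = m c /\ sval c = i t)).
  move=> t At; pose c : {b | exists2 t, A t & i t = b} := exist _ (i t) (ex_intro2 _ _ t At erefl).
  by exists (m c); [exists c|exists c].
move=> t t' y At At' [c [-> e]] [c' [/mI cc' e']]; apply: iI => //.
by rewrite -e cc' e'.
Qed.

(** Reduces the closure properties of smallness to cardinal arithmetic. *)
Lemma smallP T : small T <-> exists x, [set: T] #<= elts x.
Proof.
split=> [[f [x [fI xf]]]|[x Tx]].
  by exists x; apply: (@card_le_fun _ _ _ _ f) => [t _|t t' _ _ /fI//]; rewrite xf; exists t.
have [f [fx fI]] := card_le_ex vempty Tx.
have [y yE] : vsmall (range f).
  by apply: (vsmall_sub (vsmall_elts x)) => _ [t _ <-]; apply: fx.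
by exists f, y; split=> // t t'; apply: fI.
Qed.

Lemma small_le T U : [set: T] #<= [set: U] -> small U -> small T.
Proof.
by move=> TU /smallP[x Ux]; apply/smallP; exists x; apply: card_le_trans TU Ux.
Qed.

Lemma small_inj T U (f : T -> U) : injective f -> small U -> small T.
Proof. by move=> /card_le_inj; exact: small_le. Qed.

(** The map m only records that A is one of the types over which trees branch. *)
Lemma small_index T : small T -> exists A : Type, exists m : A -> V, [set: T] #<= [set: A].
Proof.
move=> [f [x [fI xf]]]; have [A [g xg]] := elts_index x.
exists A, g; apply: card_le_trans (card_image_le g _); rewrite -xg.
by apply: (@card_le_fun _ _ _ _ f) => [t _|t t' _ _ /fI//]; rewrite xf; exists t.
Qed.

Lemma small_type (A : Type) (g : A -> V) : small A.
Proof.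
apply/smallP; have [m [mI _]] := ordinal_enum A; exists (vsup m); rewrite elts_vsup.
by apply: (@card_le_fun _ _ _ _ m) => // x y _ _ /mI.
Qed.

Lemma small_fun T U : U -> small T -> small U -> small (T -> U).
Proof.
move=> u /small_index[A [_ TA]] /small_index[B [_ UB]].
have [j _] := card_le_exT UB.
apply: small_le (card_fun_le (j u) TA UB) _.
exact: (@small_type _ (fun _ : A -> B => vempty)).
Qed.

Lemma small_sum T U : small T -> small U -> small (T + U).
Proof.
move=> /small_index[A [_ /card_le_exT[i iI]]] /small_index[B [_ /card_le_exT[j jI]]].
apply: (small_inj (f := fun z => match z with inl t => inl (i t) | inr u => inr (j u) end) _
  (@small_type _ (fun _ : A + B => vempty))).
by move=> [t|u] [t'|u'] //= [] => [/iI|/jI] ->.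
Qed.

Section SuccessorCardinal.
Variables (T : Type).
Hypothesis Tsmall : small T.

Let kappa := succ_cardinal T.

(** By Cantor, an ordinal of size 2^|T| is too large for T; the successor
    cardinal is the least ordinal with this property. *)
Lemma succ_cardinal_spec_min : [/\ succ_cardinal_spec [set: T] kappa,
    elts kappa #<= [set: T -> bool]
  & forall d, vordinal d -> ~ (elts d #<= [set: T]) -> elts kappa `<=` elts d].
Proof.
have /smallP[x Px] := small_fun true Tsmall (small_type (fun _ : bool => vempty)).
have [th [tho thP Pth]] := ordinal_card Px.
have nT : ~ (elts th #<= [set: T]).
  by move=> thT; apply: (@cantor T); apply: card_le_trans Pth thT.
have [c [co cT] cmin] := @ordinal_least [set c | vordinal c /\ ~ (elts c #<= [set: T])]
  th (conj tho nT) (fun _ h => h.1).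
have cs d : vordinal d -> ~ (elts d #<= [set: T]) -> elts c `<=` elts d.
  move=> do_ dT; have [->//|cd] := cmin d (conj do_ dT).
  by have [dtr _] := do_; apply: dtr.
have cspec : succ_cardinal_spec [set: T] c.
  split=> [||d [do_ _] /card_ltE]; [|by apply/card_ltE|exact: cs].
  split=> // a ac; apply/card_ltE => ca; have ao := ordinal_mem co ac.
  have /(cs _ ao)/(_ _ ac)/vmem_irr// : ~ (elts a #<= [set: T]).
  move=> h; apply: cT; exact: card_le_trans ca h.
have -> : kappa = c; last by split=> //; apply: card_le_trans thP; apply: subset_card_le; apply: cs.
rewrite /kappa /succ_cardinal; case: xgetP => [d _ [dc dT dmin]|/(_ c)//].
have [cc cT' cmin'] := cspec.
by apply: elts_inj; apply/seteqP; split; [apply: dmin|apply: cmin'].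
Qed.

Lemma succ_cardinal_vordinal : vordinal kappa.
Proof. by have [[[]]] := succ_cardinal_spec_min. Qed.

Lemma succ_cardinal_gt : ~ (elts kappa #<= [set: T]).
Proof. by have [[_ /card_ltE]] := succ_cardinal_spec_min. Qed.

Lemma succ_cardinal_mem a : a ∈ kappa -> elts a #<= [set: T].
Proof.
move=> ak; apply: contrapT => aT.
have ao := ordinal_mem succ_cardinal_vordinal ak.
have [_ _ /(_ a ao aT)/(_ _ ak)] := succ_cardinal_spec_min.
exact: vmem_irr.
Qed.

(** The ordinal of A is not bounded by |T|, so it contains the successor. *)
Lemma succ_cardinal_le U (A : set U) x : A #<= elts x -> ~ (A #<= [set: T]) ->
  elts kappa #<= A.
Proof.
move=> Ax AT; have [th [tho thA Ath]] := ordinal_card Ax.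
have [_ _ kmin] := succ_cardinal_spec_min.
apply: card_le_trans thA; apply: subset_card_le; apply: kmin => // thT.
by apply: AT; apply: card_le_trans Ath thT.
Qed.

Lemma card_lt_succ_cardinal U (A : set U) :
  card_lt A (elts kappa) <-> A #<= [set: T].
Proof.
split=> [[Ak kA]|AT].
  by apply: contrapT => AT; apply: kA; exact: succ_cardinal_le Ak AT.
by apply/card_ltE => kA; apply: succ_cardinal_gt; apply: card_le_trans kA AT.
Qed.

(** Otherwise the successor would be a union of at most |T| sets of size at most
    |T|. *)
Lemma succ_cardinal_unbounded (X : set V) : [set: nat] #<= [set: T] ->
  X `<=` elts kappa -> X #<= [set: T] ->
  exists2 a, a ∈ kappa & forall b, X b -> b ∈ a.
Proof.
move=> natT Xk XT; apply: contrapT => nb; apply: succ_cardinal_gt.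
have cov : elts kappa `<=` \bigcup_(b in X) (elts b `|` [set b]).
  move=> a ak; apply: contrapT => na; apply: nb; exists a => // b Xb.
  have ko := succ_cardinal_vordinal.
  have [//|e|ab] := ordinal_total (ordinal_mem ko (Xk _ Xb)) (ordinal_mem ko ak).
    by subst b; case: na; exists a => //; right.
  by case: na; exists b => //; left.
apply: card_le_trans (subset_card_le cov) _.
apply: card_bigcup_le => // b Xb.
apply: (card_setU_le natT); first by apply: succ_cardinal_mem; apply: Xk.
by apply: card_le_trans natT; apply: (@card_le_fun _ _ _ _ (fun=> 0%N)) => // x y -> ->.
Qed.

Lemma succ_cardinal_regular : [set: nat] #<= [set: T] -> regular kappa.
Proof.
move=> natT; have [[kc kT _] _ _] := succ_cardinal_spec_min; split=> //.
  by apply/infiniteP; apply: card_le_trans natT _; have [] := kT.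
move=> X Xk Xcof; apply: contrapT => kX.
have [|a ak ha] := succ_cardinal_unbounded natT Xk.
  by apply/card_lt_succ_cardinal; apply/card_ltE.
have [b Xb] := Xcof _ ak; have ba := ha _ Xb.
by case=> [ab|/vmem_asym//]; subst b; apply: (vmem_irr ba).
Qed.

End SuccessorCardinal.

Section Regular.
Variables (lam : V) (lamR : regular lam).

Lemma regular_vordinal : vordinal lam. Proof. by have [[]] := lamR. Qed.

Lemma regular_bounded (X : set V) : X `<=` elts lam -> card_lt X (elts lam) ->
  exists2 a, a ∈ lam & forall b, X b -> b ∈ a.
Proof.
have [_ _ lamr] := lamR.
move=> Xl /card_ltE Xlt; apply: contrapT => nb; apply: Xlt; apply: lamr => // a al.
apply: contrapT => na; apply: nb; exists a => // b Xb.
have lo := regular_vordinal.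
have [//|e|ab] := ordinal_total (ordinal_mem lo (Xl _ Xb)) (ordinal_mem lo al).
  by subst b; case: na; exists a => //; left.
by case: na; exists b => //; right.
Qed.

(** If lam injected into the union, the indices would bound it: the fibre over
    each index is bounded in lam, and so is the set of these bounds. *)
Lemma regular_bigcup I U (D : set I) (F : I -> set U) :
  card_lt D (elts lam) -> (forall i, D i -> card_lt (F i) (elts lam)) ->
  card_lt (\bigcup_(i in D) F i) (elts lam).
Proof.
move=> Dl Fl; apply/card_ltE => lF.
have [[u _]|nU] := pselect (exists u : U, True); last first.
  have [_ linf _] := lamR; apply: linf.
  apply: (card_le_finite lF); rewrite (_ : \bigcup_(i in D) F i = set0) //.
  by apply/seteqP; split=> // u; case: nU; exists u.
have [g [gF gI]] := card_le_ex u lF.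
pose fib i : set V := [set a | a ∈ lam /\ F i (g a)].
have /choice[bnd bndP] i : exists b, D i -> b ∈ lam /\ forall a, fib i a -> a ∈ b.
  have [Di|nD] := pselect (D i); last by exists vempty.
  have [b bl hb] : exists2 b, b ∈ lam & forall a, fib i a -> a ∈ b.
    apply: regular_bounded => [a []//|]; apply: card_le_lt_trans (Fl _ Di).
    by apply: (@card_le_fun _ _ _ _ g) => [a []//|a a' [? _] [? _]]; apply: gI.
  by exists b.
have [c cl hc] : exists2 c, c ∈ lam & forall b, (bnd @` D) b -> b ∈ c.
  apply: regular_bounded => [_ [i /bndP[? _] <-]//|].
  by apply: card_le_lt_trans Dl; apply: card_image_le.
have [i Di Fi] := gF _ cl; have [_ /(_ c (conj cl Fi))] := bndP _ Di.
by apply/vmem_asym/hc; exists i.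
Qed.

Lemma finite_lt_regular U (A : set U) : finite_set A -> card_lt A (elts lam).
Proof.
move=> Af; apply/card_ltE => lA; have [_ linf _] := lamR; apply: linf.
exact: card_le_finite lA Af.
Qed.

Lemma regular_setU U (A B : set U) : card_lt A (elts lam) -> card_lt B (elts lam) ->
  card_lt (A `|` B) (elts lam).
Proof.
move=> Al Bl; have -> : A `|` B = \bigcup_(i in [set: bool]) (if i then A else B).
  by apply/seteqP; split=> [z [h|h]|z [[] _ h]]; [exists true|exists false|left|right].
by apply: regular_bigcup => [|[] _ //]; apply: finite_lt_regular; apply: finite_finset.
Qed.

(** By regularity a copy of A in lam is bounded; the least ordinal into which A
    embeds is then a cardinal below lam. *)
Lemma lt_regular_cardinal U (A : set U) : card_lt A (elts lam) ->
  exists mu, [/\ cardinal mu, mu ∈ lam & A #<= elts mu].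
Proof.
move=> [Al lA]; have lo := regular_vordinal.
have [f [fl fI]] := card_le_ex vempty Al.
have Af : A #<= f @` A by apply: (@card_le_fun _ _ _ _ f) => // x; exact: imageP.
have [||a al ha] := @regular_bounded (f @` A) => [_ [x Ax <-]||]; first exact: fl.
  apply/card_ltE => h; apply: lA; apply: card_le_trans h _; exact: card_image_le.
have Aa : A #<= elts a by apply: card_le_trans Af _; apply: subset_card_le.
have [mu [mul Amu] mmin] := @ordinal_least [set m | m ∈ lam /\ A #<= elts m] a
  (conj al Aa) (fun _ h => ordinal_mem lo h.1).
exists mu; split=> //; split; first exact: ordinal_mem lo mul.
move=> b bmu; apply/card_ltE => mub.
have bl : b ∈ lam by have [ltr _] := lo; exact: ltr mul _ bmu.
have [mb|mb] := mmin b (conj bl (card_le_trans Amu mub)).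
  by subst b; exact: vmem_irr bmu.
exact: vmem_asym mb bmu.
Qed.

End Regular.

(** * Stationarity *)

Section Formulas.

Fixpoint formula_tree (p : formula) : GenTree.tree nat :=
  match p with
  | fMem i j => GenTree.Node 0 [:: GenTree.Leaf i; GenTree.Leaf j]
  | fEq i j => GenTree.Node 1 [:: GenTree.Leaf i; GenTree.Leaf j]
  | fNot p => GenTree.Node 2 [:: formula_tree p]
  | fAnd p q => GenTree.Node 3 [:: formula_tree p; formula_tree q]
  | fEx p => GenTree.Node 4 [:: formula_tree p]
  end.

Lemma formula_tree_inj : injective formula_tree.
Proof.
elim=> [i j|i j|p IH|p IHp q IHq|p IH] [i' j'|i' j'|p'|p' q'|p'] //= [].
- by move=> -> ->.
- by move=> -> ->.
- by move=> /IH ->.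
- by move=> /IHp -> /IHq ->.
- by move=> /IH ->.
Qed.

Lemma card_formula : [set: formula] #<= [set: nat].
Proof. by apply: (card_le_inj (f := pickle \o formula_tree)) => p q /(pcan_inj pickleK)/formula_tree_inj. Qed.

Definition skolem (p : formula) (e : nat -> V) : V :=
  xget vempty [set x | sat setT (scons x e) p].

(** The Tarski-Vaught test. *)
Lemma sat_skolem_closed (D : set V) :
  (forall p e, (forall i, D (e i)) -> D (skolem p e)) ->
  forall p e, (forall i, D (e i)) -> (sat D e p <-> sat setT e p).
Proof.
move=> Dsk; elim=> [i j|i j|p IH|p IHp q IHq|p IH] e De //=.
- by split=> h /(IH _ De).
- by split=> -[/(IHp _ De) ? /(IHq _ De)].
- have De' x : D x -> forall i, D (scons x e i) by move=> Dx [|i] //=.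
  split=> [[x Dx /(IH _ (De' _ Dx)) h]|[x _ h]]; first by exists x.
  have Ds := Dsk p e De; exists (skolem p e) => //; apply/(IH _ (De' _ Ds)).
  by rewrite /skolem; case: xgetP => [_ _ //|/(_ x)].
Qed.

End Formulas.

Section Closure.
Variables (T : Type) (P : set V) (Phi : (T -> V) -> set V).

(** The closure of P under Phi, cut into stages whose size can be bounded by
    induction on the ordinal a. *)
Inductive stage (a : V) : V -> Prop :=
  | stage_base x : P x -> stage a x
  | stage_step b h x : b ∈ a -> (forall i, stage b (h i)) -> Phi h x -> stage a x.

Lemma stage_mono a b x : elts a `<=` elts b -> stage a x -> stage b x.
Proof.
move=> ab [y Py|c h y ca hc hy]; first exact: stage_base.
by apply: stage_step hc hy; apply: ab.
Qed.

Hypotheses (Tsmall : small T) (natT : [set: nat] #<= [set: T]).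
Variables (lam : V) (lamR : regular lam).
Hypothesis lam_pow : forall (A : set V), card_lt A (elts lam) ->
  card_lt [set h : T -> V | forall i, A (h i)] (elts lam).
Hypotheses (kappa_lt : card_lt (elts (succ_cardinal T)) (elts lam)).
Hypotheses (P_lt : card_lt P (elts lam)) (Phi_lt : forall h, card_lt (Phi h) (elts lam)).

Lemma stage_lt a : elts a `<=` elts (succ_cardinal T) -> card_lt (stage a) (elts lam).
Proof.
elim/vmem_ind: a => a IH ak.
have -> : stage a = P `|` \bigcup_(b in elts a)
    \bigcup_(h in [set h : T -> V | forall i, stage b (h i)]) Phi h.
  apply/seteqP; split=> [x [y Py|b h y ba hb hy]|x [Px|[b ba [h hb hx]]]].
  - by left.
  - by right; exists b => //; exists h.
  - exact: stage_base.
  - exact: stage_step hb hx.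
have [ktr _] := succ_cardinal_vordinal Tsmall.
apply: regular_setU => //; apply: regular_bigcup => [//||b ba].
  by apply: card_le_lt_trans kappa_lt; apply: subset_card_le.
apply: regular_bigcup => // [].
by apply: lam_pow; apply: IH => //; apply: ktr; apply: ak.
Qed.

(** Since the successor of |T| has cofinality greater than |T|, its stages
    exhaust the closure. *)
Lemma closure_exists : exists D : set V,
  [/\ P `<=` D, card_lt D (elts lam) & forall h, (forall i, D (h i)) -> Phi h `<=` D].
Proof.
set k := succ_cardinal T; have ko := succ_cardinal_vordinal Tsmall.
have [ktr _] := ko.
exists (\bigcup_(a in elts k) stage a); split.
- move=> x Px; have [|a ak _] := succ_cardinal_unbounded Tsmall natT (@sub0set _ (elts k)).
    exact: card_ge0.
  by exists a => //; apply: stage_base.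
- by apply: regular_bigcup => // a ak; apply: stage_lt; apply: ktr.
- move=> h hD; have /choice[f fP] i : exists a, a ∈ k /\ stage a (h i).
    by have [a ak ha] := hD i; exists a.
  have [||b bk hb] := @succ_cardinal_unbounded _ Tsmall (range f) natT.
  + by move=> _ [i _ <-]; have [] := fP i.
  + exact: card_image_le.
  have [||c ck bc] := @succ_cardinal_unbounded _ Tsmall [set b] natT.
  + by move=> _ ->.
  + apply: card_le_trans natT; apply: (@card_le_fun _ _ _ _ (fun=> 0%N)) => // x y -> -> //.
  move=> x hx; exists c => //; apply: stage_step (bc _ erefl) _ hx => i.
  have [fk] := fP i; apply: stage_mono.
  by have [btr _] := ordinal_mem ko bk; apply: btr; apply: hb; exists i.
Qed.

End Closure.

Section Stationary.
Variables (R : pzRingType) (L : signature R).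

Lemma card_symbol_le : [set: lmod_symbol R] #<= [set: R + nat].
Proof.
pose f (s : lmod_symbol R) : R + nat :=
  match s with Szero => inr 0%N | Sopp => inr 1%N | Sadd => inr 2%N | Sscale r => inl r end.
by apply: (card_le_inj (f := f)) => -[|||r] [|||r'] //= [->].
Qed.

Lemma small_symbol : small (lmod_symbol R).
Proof. by exists (sym L), (sig_set L); split; [exact: sym_inj|exact: sig_setE]. Qed.

Lemma small_nat : small nat. Proof. exact: (@small_type _ (fun=> vempty)). Qed.

Lemma small_ring : small R.
Proof. by apply: (small_inj (f := @Sscale R)) small_symbol => r r' []. Qed.

Lemma small_ring_nat : small (R + nat).
Proof. exact: small_sum small_ring small_nat. Qed.

Lemma nat_le_ring_nat : [set: nat] #<= [set: R + nat].
Proof. by apply: (card_le_inj (f := @inr R nat)) => ? ? []. Qed.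

Section Lambda.
Variables (lam : V) (lamR : regular lam).
Hypothesis lam_pow : forall mu : V, cardinal mu -> mu ∈ lam ->
  card_lt [set h : R + nat -> V | forall i, h i ∈ mu] (elts lam).
Let T := (R + nat)%type.
Let kappa := succ_cardinal T.

(** A set smaller than lam embeds into a cardinal below lam. *)
Lemma lt_regular_pow U (A : set U) : card_lt A (elts lam) ->
  card_lt [set h : T -> U | forall i, A (h i)] (elts lam).
Proof.
move=> /(lt_regular_cardinal lamR)[mu [muc mul Amu]].
have [f [fm fI]] := card_le_ex vempty Amu.
apply: card_le_lt_trans (lam_pow muc mul).
apply: (@card_le_fun _ _ _ _ (fun h => f \o h)) => [h hA i|h h' hA hA' e].
  by apply: fm.
by apply: funext => i; apply: fI => //; have := congr1 (@^~ i) e.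
Qed.

Lemma succ_cardinal_lt : card_lt (elts kappa) (elts lam).
Proof.
have [_ k2 _] := succ_cardinal_spec_min small_ring_nat.
apply: card_le_lt_trans k2 _.
have := @lt_regular_pow bool setT (finite_lt_regular lamR finite_finset).
by apply: card_le_lt_trans; apply: subset_card_le.
Qed.

Lemma ring_nat_lt : card_lt [set: T] (elts lam).
Proof.
have [[_ [Tk _] _] _ _] := succ_cardinal_spec_min small_ring_nat.
exact: card_le_lt_trans Tk succ_cardinal_lt.
Qed.

(** The three parts provide closure under small subsets, elementarity, and
    transitivity of the intersection with lam. *)
Definition closing_op (h : T -> V) : set V :=
  [set vset (range h)] `|` range (fun p => skolem p (h \o inr)) `|`
  [set x | h (inr 0%N) ∈ lam /\ x ∈ h (inr 0%N)].

Lemma closing_op_lt h : card_lt (closing_op h) (elts lam).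
Proof.
have nl : card_lt [set: nat] (elts lam).
  exact: card_le_lt_trans nat_le_ring_nat ring_nat_lt.
apply: regular_setU => //; first apply: regular_setU => //.
- exact/finite_lt_regular/finite_set1.
- apply: card_le_lt_trans (card_image_le _ _) (card_le_lt_trans card_formula nl).
- have [hl|n] := pselect (h (inr 0%N) ∈ lam); last first.
    rewrite (_ : [set x | _] = set0); first exact/finite_lt_regular/finite_set0.
    by apply/seteqP; split=> x // [].
  have [[_ /(_ _ hl) hl1] _ _] := lamR; apply: card_le_lt_trans hl1.
  by apply: subset_card_le => x [].
Qed.

Lemma closed_appropriate_stationary : stationary lam (closed_appropriate L kappa lam).
Proof.
split=> //.
- move=> lc; have [_] := ring_nat_lt; apply; apply: card_le_trans lc _.
  exact: nat_le_ring_nat.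
- by move=> N [].
move=> P0 P0l.
pose P := elts P0 `|` elts (sig_set L) `|` [set sig_set L; vempty].
have Pl : card_lt P (elts lam).
  apply: regular_setU => //; last exact/finite_lt_regular/finite_set2.
  apply: regular_setU => //; apply: card_le_lt_trans ring_nat_lt.
  by rewrite sig_setE; apply: card_le_trans card_symbol_le; apply: card_image_le.
have [D [PD Dl Dcl]] := @closure_exists T P closing_op small_ring_nat
  nat_le_ring_nat lam lamR (@lt_regular_pow V) succ_cardinal_lt Pl closing_op_lt.
have [N NE] : vsmall D by apply: (card_le_vsmall Dl.1); exists lam; apply: card_lexx.
have [ltr ltot] := regular_vordinal lamR.
have Nsat : forall p e, (forall i, e i ∈ N) -> (sat (elts N) e p <-> sat setT e p).
  apply: sat_skolem_closed => p e eN; rewrite NE.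
  apply: (Dcl (fun i => if i is inr n then e n else e 0%N)).
    by move=> i; rewrite -NE; case: i => [r|n]; apply: eN.
  by left; right; exists p.
have Nel : Sigma1_elementary N.
  split; first by exists vempty; rewrite NE; apply: PD; right; right.
  by move=> p _ e; apply: Nsat.
exists N; split=> //.
- split; first by rewrite NE.
    split=> //; first by rewrite NE => x xL; apply: PD; left; right.
    by rewrite -[_ ∈ _]/(elts N _) NE; apply: PD; right; left.
  move=> x xN /(card_lt_succ_cardinal small_ring_nat) xT.
  rewrite -[_ ∈ _]/(elts N _) NE.
  (* only the empty set is not the range of a function from R + nat *)
  have [x0|/surjfunPex[h hx]] := pfcard_geP xT.
    apply: PD; right; right; apply: elts_inj; rewrite x0 elts_vsup.
    by apply/seteqP; split=> // _ [[]].
  apply: (Dcl h); first by move=> i; rewrite -NE; apply: xN; rewrite hx; exists i.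
  left; left; rewrite /= -hx; apply: elts_inj; apply/esym/vsetE.
  exact: vsmall_elts.
- by move=> x xP; rewrite NE; apply: PD; left; left.
- split=> [x [xN xl] y yx|x y [_ xl] [_ yl]]; last exact: ltot.
  split; last exact: ltr yx.
  rewrite NE; apply: (Dcl (fun=> x)); first by move=> _; rewrite -NE.
  by right.
Qed.

End Lambda.
End Stationary.

(** * Reflection of bounded statements *)

(** P is expressed by a bounded formula whose variables are read off a context
    t : T through v. *)
Definition bounded_def T (v : T -> nat -> V) (P : T -> Prop) : Prop :=
  exists2 p, Delta0 p & forall t, sat setT (v t) p <-> P t.

Definition bounded_var T (v : T -> nat -> V) (x : T -> V) : Prop :=
  exists i, forall t, x t = v t i.

Definition push T (v : T -> nat -> V) (z : T * V) : nat -> V := scons z.2 (v z.1).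

Section BoundedDef.
Variables (T : Type) (v : T -> nat -> V).
Implicit Types (P Q : T -> Prop).

Lemma bounded_ext P Q : (forall t, P t <-> Q t) -> bounded_def v P -> bounded_def v Q.
Proof. by move=> PQ [p pD pP]; exists p => // t; rewrite pP. Qed.

Lemma bounded_mem (x y : T -> V) : bounded_var v x -> bounded_var v y ->
  bounded_def v (fun t => x t ∈ y t).
Proof.
by move=> [i xi] [j yj]; exists (fMem i j) => [|t]; [constructor|rewrite xi yj].
Qed.

Lemma bounded_eq (x y : T -> V) : bounded_var v x -> bounded_var v y ->
  bounded_def v (fun t => x t = y t).
Proof.
by move=> [i xi] [j yj]; exists (fEq i j) => [|t]; [constructor|rewrite xi yj].
Qed.

Lemma bounded_not P : bounded_def v P -> bounded_def v (fun t => ~ P t).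
Proof.
by move=> [p pD pP]; exists (fNot p) => [|t /=]; [constructor|rewrite pP].
Qed.

Lemma bounded_and P Q : bounded_def v P -> bounded_def v Q ->
  bounded_def v (fun t => P t /\ Q t).
Proof.
by move=> [p pD pP] [q qD qQ]; exists (fAnd p q) => [|t /=]; [constructor|rewrite pP qQ].
Qed.

Lemma bounded_or P Q : bounded_def v P -> bounded_def v Q ->
  bounded_def v (fun t => P t \/ Q t).
Proof.
move=> hP hQ; apply: bounded_ext (bounded_not (bounded_and (bounded_not hP) (bounded_not hQ))) => t.
by rewrite not_andE !not_notE.
Qed.

Lemma bounded_imp P Q : bounded_def v P -> bounded_def v Q ->
  bounded_def v (fun t => P t -> Q t).
Proof.
move=> hP hQ; apply: bounded_ext (bounded_or (bounded_not hP) hQ) => t.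
by rewrite implyE.
Qed.

Lemma bounded_bex (x : T -> V) (P : T -> V -> Prop) : bounded_var v x ->
  bounded_def (push v) (fun z => P z.1 z.2) ->
  bounded_def v (fun t => exists y, y ∈ x t /\ P t y).
Proof.
move=> [i xi] [p pD pP]; exists (fEx (fAnd (fMem 0 i.+1) p)) => [|t /=].
  by constructor.
split=> [[y _ [yx /(pP (t, y)) hP]]|[y [yx /(pP (t, y)) hP]]].
  by exists y; rewrite xi.
by exists y => //; rewrite -xi.
Qed.

End BoundedDef.

Section BoundedForall.
Variables (T : Type) (v : T -> nat -> V).

Lemma bounded_ball (x : T -> V) (P : T -> V -> Prop) : bounded_var v x ->
  bounded_def (push v) (fun z => P z.1 z.2) ->
  bounded_def v (fun t => forall y, y ∈ x t -> P t y).
Proof.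
move=> hx hP.
apply: (@bounded_ext _ _ (fun t => ~ exists y, y ∈ x t /\ ~ P t y)); last first.
  by apply: bounded_not; apply: bounded_bex => //; cbv beta; apply: bounded_not.
move=> t; split=> [n y yx|h [y [/h hP']]//].
by apply: contrapT => nP; apply: n; exists y.
Qed.

End BoundedForall.

(* The variables of the formulas below have indices at most 12. *)
Ltac bounded_var_tac := first
  [ assumption
  | match goal with H : bounded_var _ ?x |- bounded_var _ (fun _ => ?x _) =>
      let i := fresh in let E := fresh in
      case: H => i E; first [exists i; intro; exact: E | exists i.+1; intro; exact: E
        | exists i.+2; intro; exact: E | exists i.+3; intro; exact: E]
    end
  | by exists 0%N | by exists 1%N | by exists 2 | by exists 3 | by exists 4 | by exists 5
  | by exists 6 | by exists 7 | by exists 8 | by exists 9 | by exists 10 | by exists 11 | by exists 12 ].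

Ltac bounded_tac := repeat (first
  [ progress cbv beta | apply: bounded_and | apply: bounded_or | apply: bounded_imp | apply: bounded_bex
  | apply: bounded_ball | (apply: bounded_mem; bounded_var_tac)
  | (apply: bounded_eq; bounded_var_tac) | bounded_var_tac]).

Section Pairs.
Variables (T : Type) (v : T -> nat -> V).

Lemma bounded_vset2 (z x y : T -> V) :
  bounded_var v z -> bounded_var v x -> bounded_var v y ->
  bounded_def v (fun t => z t = vset [set x t; y t]).
Proof.
move=> zv xv yv.
apply: (@bounded_ext _ _ (fun t => x t ∈ z t /\ y t ∈ z t /\
    forall u, u ∈ z t -> u = x t \/ u = y t)); last by bounded_tac.
move=> t; split=> [[xz [yz h]]|->].
  by apply: vext => u; rewrite in_vset2; split=> [/h//|[->|->]].
by split; [|split]=> [||u]; rewrite in_vset2; auto.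
Qed.

Lemma bounded_vset1 (z x : T -> V) : bounded_var v z -> bounded_var v x ->
  bounded_def v (fun t => z t = vset [set x t]).
Proof.
move=> zv xv; apply: bounded_ext (bounded_vset2 zv xv xv) => t.
by rewrite setUid.
Qed.

End Pairs.

Section Tuples.
Variables (T : Type) (v : T -> nat -> V).

Lemma bounded_pair (z x y : T -> V) :
  bounded_var v z -> bounded_var v x -> bounded_var v y ->
  bounded_def v (fun t => z t = vpair (x t) (y t)).
Proof.
move=> zv xv yv.
apply: (@bounded_ext _ _ (fun t => (exists u, u ∈ z t /\ u = vset [set x t]) /\
   (exists u, u ∈ z t /\ u = vset [set x t; y t]) /\
   forall u, u ∈ z t -> u = vset [set x t] \/ u = vset [set x t; y t])).
  move=> t; split=> [[[u1 [xz e1]] [[u2 [yz e2]] h]]|->].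
    subst u1 u2.
    by apply: vext => u; rewrite in_vpair; split=> [/h//|[->|->]].
  split; [|split] => [||u]; last by rewrite in_vpair.
    by eexists; split; last reflexivity; rewrite in_vpair; left.
  by eexists; split; last reflexivity; rewrite in_vpair; right.
by bounded_tac; first [apply: bounded_vset1|apply: bounded_vset2]; bounded_var_tac.
Qed.

End Tuples.

Section Triples.
Variables (T : Type) (v : T -> nat -> V).

Lemma bounded_pair_mem (h x y : T -> V) :
  bounded_var v h -> bounded_var v x -> bounded_var v y ->
  bounded_def v (fun t => vpair (x t) (y t) ∈ h t).
Proof.
move=> hv xv yv.
apply: (@bounded_ext _ _ (fun t => exists p, p ∈ h t /\ p = vpair (x t) (y t))).
  by move=> t; split=> [[p [? <-]]|?] //; eexists; split; last reflexivity.
apply: bounded_bex => //; cbv beta; apply: bounded_pair; bounded_var_tac.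
Qed.

(** The inner pair of a triple lies in an element of it. *)
Lemma bounded_triple (z x y w : T -> V) :
  bounded_var v z -> bounded_var v x -> bounded_var v y -> bounded_var v w ->
  bounded_def v (fun t => z t = vpair (x t) (vpair (y t) (w t))).
Proof.
move=> zv xv yv wv.
apply: (@bounded_ext _ _ (fun t => exists s, s ∈ z t /\ exists u, u ∈ s /\
   (u = vpair (y t) (w t) /\ z t = vpair (x t) u))).
  move=> t; split=> [[s [_ [u [_ [-> ->]]]]]//|->].
  exists (vset [set x t; vpair (y t) (w t)]); rewrite in_vpair; split; first by right.
  by eexists; rewrite in_vset2; split; [right; reflexivity|].
by do 2!(apply: bounded_bex; first bounded_var_tac; cbv beta);
  apply: bounded_and; apply: bounded_pair; bounded_var_tac.
Qed.

Lemma bounded_pair_pair_mem (h x y w : T -> V) :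
  bounded_var v h -> bounded_var v x -> bounded_var v y -> bounded_var v w ->
  bounded_def v (fun t => vpair (vpair (x t) (y t)) (w t) ∈ h t).
Proof.
move=> hv xv yv wv.
apply: (@bounded_ext _ _ (fun t => exists p, p ∈ h t /\ exists s, s ∈ p /\ exists u, u ∈ s /\
   (u = vpair (x t) (y t) /\ p = vpair u (w t)))).
  move=> t; split=> [[p [hp [s [_ [u [_ [-> <-]]]]]]]//|hp].
  exists (vpair (vpair (x t) (y t)) (w t)); split=> //.
  exists (vset [set vpair (x t) (y t)]); rewrite in_vpair; split; first by left.
  by exists (vpair (x t) (y t)); rewrite in_vset1.
by do 3!(apply: bounded_bex; first bounded_var_tac; cbv beta);
  apply: bounded_and; apply: bounded_pair; bounded_var_tac.
Qed.

End Triples.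

(** Sigma_1 elementarity transfers the existence of witnesses down to N and the
    matrix back up to V. *)
Lemma Sigma1_elementary_witness (N : V) (P : (nat -> V) -> V -> V -> Prop) :
  Sigma1_elementary N ->
  bounded_def (push (push id)) (fun z => P z.1.1 z.1.2 z.2) ->
  forall e, (forall i, e i ∈ N) -> (exists x y, P e x y) ->
  exists x y, [/\ x ∈ N, y ∈ N & P e x y].
Proof.
move=> [_ Nel] [p pD pP] e eN [x [y Pxy]].
have : sat setT e (fEx (fEx p)).
  by exists x => //; exists y => //; apply/(pP (e, x, y)).
have S1 : Sigma1 (fEx (fEx p)) by do 2!apply: Sigma1_ex; apply: Sigma1_Delta0.
move=> /(Nel _ S1 _ eN) [x' x'N [y' y'N]].
have N' : forall i, scons y' (scons x' e) i ∈ N by move=> [|[|i]] /=.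
move=> /(Nel _ (Sigma1_Delta0 pD) _ N')/(pP (e, x', y')) h.
by exists x', y'.
Qed.

Local Open Scope ring_scope.

(** * An elementary criterion for flat Mittag-Leffler modules *)

Section Combinations.
Variable R : pzRingType.

Definition mmul (I J K : finType) (A : I -> J -> R) (B : J -> K -> R) (i : I) (k : K) : R :=
  \sum_j A i j * B j k.

Definition combo (M : lmodType R) (I J : finType) (A : I -> J -> R) (y : J -> M) (i : I) : M :=
  \sum_j A i j *: y j.

Lemma mmulA (I J K L : finType) (A : I -> J -> R) (B : J -> K -> R) (C : K -> L -> R) i l :
  mmul (mmul A B) C i l = mmul A (mmul B C) i l.
Proof.
rewrite /mmul; under eq_bigr do rewrite mulr_suml.
rewrite exchange_big /=; apply: eq_bigr => j _.
by rewrite mulr_sumr; apply: eq_bigr => k _; rewrite mulrA.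
Qed.

Lemma eq_mmull (I J K : finType) (A A' : I -> J -> R) (B : J -> K -> R) i k :
  A i =1 A' i -> mmul A B i k = mmul A' B i k.
Proof. by move=> e; apply: eq_bigr => j _; rewrite e. Qed.

Lemma eq_mmulr (I J K : finType) (A : I -> J -> R) (B B' : J -> K -> R) i k :
  B =2 B' -> mmul A B i k = mmul A B' i k.
Proof. by move=> e; apply: eq_bigr => j _; rewrite e. Qed.

Definition join T (I J : finType) (x : I -> T) (y : J -> T) (k : I + J) : T :=
  match k with inl i => x i | inr j => y j end.

(** The positive primitive formula expressing that A divides m generates the
    positive primitive type of m. With D the identity, the columns of A generate
    the least submodule of R^I over which m factors. *)
Definition minimal_factor (M : lmodType R) (I J : finType) (m : I -> M)
    (A : I -> J -> R) (y : J -> M) : Prop :=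
  m =1 combo A y /\
  forall (T K : finType) (D : T -> I -> R) (B : T -> K -> R) (z : K -> M),
    combo D m =1 combo B z -> exists C : K -> J -> R, mmul D A =2 mmul B C.

(** Flat Mittag-Leffler, in terms of linear equations in M. *)
Definition factorizable (M : lmodType R) : Prop :=
  forall (I : finType) (m : I -> M), exists (J : finType) (A : I -> J -> R) (y : J -> M),
    minimal_factor m A y.

(** The equational criterion for flatness, for finitely many relations at once. *)
Definition equational (M : lmodType R) : Prop :=
  forall (T I : finType) (D : T -> I -> R) (m : I -> M), combo D m =1 (fun=> 0) ->
    exists (J : finType) (A : I -> J -> R) (y : J -> M),
      m =1 combo A y /\ mmul D A =2 (fun _ _ => 0).

Lemma factorizable_equational M : factorizable M -> equational M.
Proof.
move=> Mf T I D m Dm; have [J [A [y [mA Amin]]]] := Mf I m.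
exists J, A, y; split=> //.
have [|C DA] := Amin T void D (fun _ v => match v with end) (fun v => match v with end).
  by move=> t; rewrite Dm /combo big1 // => -[].
by move=> t l; rewrite DA /mmul big1 // => -[].
Qed.

End Combinations.

(** * Vanishing sums of tensors *)

Section Tensors.
Variables (R : pzRingType) (Q : lmodType R^c) (M : lmodType R).

HB.instance Definition _ (A : zmodType) (B : Q -> M -> A) :=
  GRing.isZmodMorphism.Build {freeg (Q * M)} A (free_lift B) (free_liftB B).

Lemma tens0r (q : Q) : tens q (0 : M) = 0.
Proof.
by have [_ h _] := tens_balanced Q M; have := h q 0 0; rewrite addr0 => /eqP; rewrite -subr_eq subrr => /eqP <-.
Qed.

Lemma tens0l (m : M) : tens (0 : Q) m = 0.
Proof.
by have [h _ _] := tens_balanced Q M; have := h 0 0 m; rewrite addr0 => /eqP; rewrite -subr_eq subrr => /eqP <-.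
Qed.

Lemma tens_suml (I : finType) (q : I -> Q) (m : M) : tens (\sum_i q i) m = \sum_i tens (q i) m.
Proof.
have [h _ _] := tens_balanced Q M.
exact: (big_morph (fun x => tens x m) (fun x y => h x y m) (tens0l m)).
Qed.

Lemma tens_sumr (I : finType) (q : Q) (m : I -> M) : tens q (\sum_i m i) = \sum_i tens q (m i).
Proof.
have [_ h _] := tens_balanced Q M.
exact: (big_morph (fun x => tens q x) (h q) (tens0r q)).
Qed.

Lemma tens_combo (I J : finType) (q : I -> Q) (A : I -> J -> R) (y : J -> M) :
  \sum_i tens (q i) (combo A y i) = \sum_j tens (\sum_i (A i j : R^c) *: q i) (y j).
Proof.
have [_ _ hz] := tens_balanced Q M.
under [RHS]eq_bigr do rewrite tens_suml.
rewrite exchange_big /=; apply: eq_bigr => i _; rewrite tens_sumr.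
by apply: eq_bigr => j _; rewrite hz.
Qed.

Lemma tensN (q : Q) (m : M) : tens (- q) m = - tens q m.
Proof.
have [h _ _] := tens_balanced Q M; apply/eqP; rewrite -subr_eq0 opprK -h addNr.
by rewrite tens0l.
Qed.

Lemma tensor_sum (t : tensor Q M) :
  exists n (q : 'I_n -> Q) (m : 'I_n -> M), t = \sum_i tens (q i) (m i).
Proof.
suff [s ->] : exists s : seq (Q * M), t = \sum_(z <- s) tens z.1 z.2.
  exists (size s), (fun i => (tnth (in_tuple s) i).1), (fun i => (tnth (in_tuple s) i).2).
  by rewrite big_tnth.
pose E (x : {freeg (Q * M)}) := exists s : seq (Q * M), \pi_(tensor Q M) x = \sum_(z <- s) tens z.1 z.2.
suff EE x : E x by have [s e] := EE (repr t); exists s; rewrite -e reprK.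
have E0 : E 0 by exists [::]; rewrite big_nil -[0 in LHS](subrr 0) pi_tensorB subrr.
have EB y z : E y -> E z -> E (y - z).
  move=> [s sy] [s' sz]; exists (s ++ [seq (- p.1, p.2) | p <- s']).
  rewrite pi_tensorB sy sz big_cat big_map /= -sumrN; congr (_ + _).
  by apply: eq_bigr => p _; rewrite tensN.
have EN y : E y -> E (- y) by move=> /(EB _ _ E0); rewrite sub0r.
have ED y z : E y -> E z -> E (y + z) by move=> Ey /EN /(EB _ _ Ey); rewrite opprK.
have EU p : E << p >> by exists [:: p]; rewrite big_seq1; case: p.
have EM (p : Q * M) (k : int) : E << k *g p >>.
  have EMn n : E << n%:Z *g p >>.
    elim: n => [|n IH]; first by rewrite freegU0.
    by rewrite -addn1 PoszD -freegUD; apply: ED.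
  by case: k => n; [exact: EMn|rewrite NegzE -freegUN; apply: EN].
rewrite -(freeg_sumE x); elim/big_ind: _ => // p _; exact: EM.
Qed.

(** A derivation that a formal sum vanishes in the tensor product uses only the
    additivity and the R-linearity of finitely many elements of M, which are
    recorded in rho as linear relations; it remains valid for any a : M -> R that
    respects these. *)
Lemma tensor_rel_finite (x : {freeg (Q * M)}) : tensor_rel x ->
  exists2 rho : seq (seq (R * M)),
    forall r, r \in rho -> \sum_(c <- r) c.1 *: c.2 = 0
  & forall a : M -> R, (forall r, r \in rho -> \sum_(c <- r) c.1 * a c.2 = 0) ->
      free_lift (fun (q : Q) m => (a m : R^c) *: q) x = 0.
Proof.
elim=> [|y z _ [r ry hy] _ [r' rz hz]|q q' m|q m m'|r q m].
- by exists [::] => // a _; rewrite raddf0.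
- exists (r ++ r') => [s|a ha]; first by rewrite mem_cat => /orP[/ry|/rz].
  by rewrite raddfB /= hy ?hz ?subrr // => s sr; apply: ha; rewrite mem_cat sr ?orbT.
- exists [::] => // a _; rewrite !raddfB /= !free_liftU scalerDr.
  by rewrite addrAC addrK subrr.
- exists [:: [:: (1, m + m'); (-1, m); (-1, m')]] => [s|a ha].
    rewrite inE => /eqP->; rewrite !big_cons big_nil /= addr0 !scaleN1r scale1r.
    by rewrite -opprD subrr.
  rewrite !raddfB /= !free_liftU -!scalerBl.
  have := ha _ (mem_head _ _); rewrite !big_cons big_nil /= addr0 !mulN1r mul1r addrA.
  by move=> e; rewrite [X in X *: q]e scale0r.
- exists [:: [:: (r, m); (-1, r *: m)]] => [s|a ha].
    by rewrite inE => /eqP->; rewrite !big_cons big_nil /= addr0 scaleN1r subrr.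
  rewrite !raddfB /= !free_liftU scalerA -scalerBl.
  have := ha _ (mem_head _ _); rewrite !big_cons big_nil /= addr0 mulN1r.
  by move=> e; rewrite [X in X *: q]e scale0r.
Qed.

Lemma pi_tensor_sum (I : finType) (F : I -> {freeg (Q * M)}) :
  \pi_(tensor Q M) (\sum_i F i) = \sum_i \pi_(tensor Q M) (F i).
Proof.
have pi0 : \pi_(tensor Q M) 0 = 0 by rewrite -[0 in LHS](subrr 0) pi_tensorB subrr.
apply: (big_morph _ _ pi0) => x y.
by rewrite -[y in LHS]opprK pi_tensorB -[- y]sub0r pi_tensorB pi0 sub0r opprK.
Qed.

(** Over an equational module, the finitely many relations used to annihilate a
    sum of tensors can be solved together. *)
Lemma tensor_vanish (I : finType) (q : I -> Q) (m : I -> M) : equational M ->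
  \sum_i tens (q i) (m i) = 0 ->
  exists (J : finType) (A : I -> J -> R) (y : J -> M),
    m =1 combo A y /\ forall j, \sum_i (A i j : R^c) *: q i = 0.
Proof.
move=> Meq; rewrite -pi_tensor_sum => e.
have /tensor_rel_finite[rho rho0 hrho] : tensor_rel (\sum_i << (q i, m i) >>).
  rewrite -[X in tensor_rel X]subr0; apply/pi_tensorE.
  by rewrite e -[0 in RHS](subrr 0) pi_tensorB subrr.
pose s := [seq m i | i <- enum I] ++ flatten [seq [seq c.2 | c <- r] | r <- rho].
have ms i : m i \in s by rewrite mem_cat; apply/orP; left; apply: map_f; rewrite mem_enum.
have rs r c : r \in rho -> c \in r -> c.2 \in s.
  move=> rr cr; rewrite mem_cat; apply/orP; right; apply/flattenP.
  by exists [seq c.2 | c <- r]; [apply: map_f|apply: map_f].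
pose D (t : seq_sub rho) (x : seq_sub s) := \sum_(c <- val t | c.2 == val x) c.1.
have DE (Z : zmodType) (t : seq_sub rho) (F : R -> seq_sub s -> Z) (G : R * M -> Z) :
    (forall x, {morph F^~ x : a b / a + b}) -> (forall x, F 0 x = 0) ->
    (forall c x, c.2 = val x -> F c.1 x = G c) ->
    \sum_x F (D t x) x = \sum_(c <- val t) G c.
  move=> FD F0 FG.
  under eq_bigr => x _ do rewrite (big_morph (F^~ x) (FD x) (F0 x)) big_mkcond /=.
  rewrite exchange_big /= big_seq [RHS]big_seq; refine (eq_bigr _ _) => c ct.
  have cs : c.2 \in s by apply: rs ct; exact: valP.
  rewrite -big_mkcond /= (big_pred1 (SeqSub cs)) => [|x /=]; first exact: FG.
  by rewrite -val_eqE eq_sym.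
have [|J [E [w [wE DE0]]]] := Meq _ _ D val.
  move=> t; rewrite /combo (DE _ _ (fun a x => a *: val x) (fun c => c.1 *: c.2)).
  - exact/rho0/valP.
  - by move=> x a b; rewrite scalerDl.
  - by move=> x; rewrite scale0r.
  - by move=> c x ->.
pose a j (z : M) : R := if insub z is Some x then E x j else 0.
have aE j x : a j (val x) = E x j by rewrite /a valK.
exists J, (fun i j => a j (m i)), w; split=> [i|j].
  have := wE (SeqSub (ms i)) => /= ->; apply: eq_bigr => j _.
  by rewrite -(aE j (SeqSub (ms i))).
have {}hrho : free_lift (fun (q : Q) m => (a j m : R^c) *: q) (\sum_i << (q i, m i) >>) = 0.
  apply: hrho => r rr; apply: etrans (DE0 (SeqSub rr) j); rewrite /mmul.
  rewrite (DE _ _ (fun b x => b * E x j) (fun c => c.1 * a j c.2)) //.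
  - by move=> x b c; rewrite mulrDl.
  - by move=> x; rewrite mul0r.
  - by move=> c x ->; rewrite aE.
by apply: etrans hrho; rewrite raddf_sum /=; apply: eq_bigr => i _; rewrite free_liftU.
Qed.

End Tensors.

Section TensorMaps.
Variables (R : pzRingType) (M : lmodType R).

Lemma tensor_lift0 (Q : lmodType R^c) (Z : zmodType) (B : Q -> M -> Z) : balanced B ->
  tensor_lift B 0 = 0.
Proof. by move=> /tensor_liftB hD; rewrite -[0 in LHS](subrr 0) hD subrr. Qed.

Lemma tensor_lift_sum (Q : lmodType R^c) (Z : zmodType) (B : Q -> M -> Z) (I : finType)
    (q : I -> Q) (m : I -> M) : balanced B ->
  tensor_lift B (\sum_i tens (q i) (m i)) = \sum_i B (q i) (m i).
Proof.
move=> hB; have hD := tensor_liftB hB.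
have h0 := tensor_lift0 hB.
under [RHS]eq_bigr do rewrite -(tensor_lift_tens hB).
apply: (big_morph _ _ h0) => x y.
by rewrite -[y in LHS]opprK hD -[- y]sub0r hD h0 sub0r opprK.
Qed.

Lemma tensor_map_sum (Q Q' : lmodType R^c) (g : {linear Q -> Q'}) (I : finType)
    (q : I -> Q) (m : I -> M) :
  tensor_map g (\sum_i tens (q i) (m i)) = \sum_i tens (g (q i)) (m i).
Proof. exact/tensor_lift_sum/tensor_map_balanced. Qed.

Lemma prod_tensor_balanced (I : Type) (Q : I -> lmodType R^c) (i : I) :
  balanced (fun (p : product Q) (x : M) => tens (p i) x).
Proof.
have [hl hr hz] := tens_balanced (Q i) M.
by split=> [p p' x|p x y|r p x]; [rewrite -hl|exact: hr|rewrite -hz].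
Qed.

Lemma prod_tensor_map_sum (I : Type) (Q : I -> lmodType R^c) (J : finType)
    (q : J -> product Q) (m : J -> M) (i : I) :
  prod_tensor_map (\sum_j tens (q j) (m j)) i = \sum_j tens (q j i) (m j).
Proof. exact: (tensor_lift_sum _ _ (prod_tensor_balanced Q i)). Qed.

Lemma tens_combo0 (Q : lmodType R^c) (I J : finType) (q : I -> Q) (m : I -> M)
    (A : I -> J -> R) (y : J -> M) : m =1 combo A y ->
  (forall j, \sum_i (A i j : R^c) *: q i = 0) -> \sum_i tens (q i) (m i) = 0.
Proof.
move=> mA qA; under eq_bigr do rewrite mA.
by rewrite tens_combo big1 // => j _; rewrite qA tens0l.
Qed.

Lemma scale_mmul (Q : lmodType R^c) (I J K : finType) (q : I -> Q) (A : I -> J -> R)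
    (B : J -> K -> R) k :
  \sum_i (mmul A B i k : R^c) *: q i = \sum_j (B j k : R^c) *: \sum_i (A i j : R^c) *: q i.
Proof.
under [RHS]eq_bigr do rewrite scaler_sumr; rewrite exchange_big /=.
apply: eq_bigr => i _; under [RHS]eq_bigr do rewrite scalerA.
by rewrite -scaler_suml.
Qed.

Lemma minimal_factor_divides (I J K : finType) (m : I -> M) (A : I -> J -> R) (y : J -> M)
    (B : I -> K -> R) (z : K -> M) : minimal_factor m A y -> m =1 combo B z ->
  exists C : K -> J -> R, A =2 mmul B C.
Proof.
move=> [_ Amin] mB; pose D (i k : I) : R := (i == k)%:R.
have D1 (Z : lmodType R) (x : I -> Z) i : combo D x i = x i.
  rewrite /combo (bigD1 i) //= /D eqxx scale1r big1 ?addr0 // => k ki.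
  by rewrite eq_sym (negbTE ki) scale0r.
have [|C DA] := Amin I K D B z; first by move=> i; rewrite D1.
by exists C => i j; rewrite -DA -[LHS](D1 R^o (A^~ j)).
Qed.

(** The factorization given by the vanishing of the image is pulled back along g. *)
Lemma factorizable_flat : factorizable M -> flat M.
Proof.
move=> /factorizable_equational Meq Q Q' g _ _ gI t u tu.
have gB := tensor_map_balanced M g.
suff : t - u = 0 by move/eqP; rewrite subr_eq0 => /eqP.
have [n [q [m tuE]]] := tensor_sum (t - u); rewrite tuE.
have : \sum_i tens (g (q i)) (m i) = 0.
  by rewrite -tensor_map_sum -tuE /tensor_map tensor_liftB // -!/(tensor_map g _) tu subrr.
move=> /(tensor_vanish Meq)[J [A [y [mA qA]]]].
apply: tens_combo0 mA _ => j; apply: gI; rewrite linear_sum linear0 -[RHS](qA j).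
by apply: eq_bigr => i _; rewrite linearZ.
Qed.

(** The minimal matrix of m divides each of the matrices that make the tensor
    vanish at an index, hence is killed at all indices simultaneously. *)
Lemma factorizable_mittag_leffler : factorizable M -> mittag_leffler M.
Proof.
move=> Mf; have Meq := factorizable_equational Mf.
move=> I Q _ _ t u tu.
suff : t - u = 0 by move/eqP; rewrite subr_eq0 => /eqP.
have [n [q [m tuE]]] := tensor_sum (t - u); rewrite tuE.
have [J [A [y Amin]]] := Mf _ m.
apply: tens_combo0 Amin.1 _ => j; apply: functional_extensionality_dep => i.
have : \sum_k tens (q k i) (m k) = 0.
  rewrite -prod_tensor_map_sum -tuE /prod_tensor_map /tensor_map tensor_liftB.
    by have := congr1 (@^~ i) tu; rewrite /prod_tensor_map /tensor_map => ->; rewrite subrr.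
  exact: prod_tensor_balanced.
move=> /(tensor_vanish Meq)[K [B [z [mB qB]]]].
have [C AC] := minimal_factor_divides Amin mB.
have -> : (\sum_k (A k j : R^c) *: q k) i = \sum_k (A k j : R^c) *: q k i.
  by rewrite (big_morph (fun p : product Q => p i) (id1 := 0) (op1 := +%R)).
under eq_bigr do rewrite AC.
by rewrite scale_mmul big1 // => k _; rewrite qB scaler0.
Qed.

End TensorMaps.

(** * From flat Mittag-Leffler modules to minimal factors *)

Section FlatVanish.
Variables (R : pzRingType) (M : lmodType R) (Q : lmodType R^c) (I : finType) (q : I -> Q).

Definition span_pred : {pred Q} := fun x => `[< exists a : I -> R, x = \sum_i (a i : R^c) *: q i >].

Lemma span_closed : GRing.submod_closed span_pred.
Proof.
split; first by apply/asboolP; exists (fun=> 0); rewrite big1 // => i _; rewrite scale0r.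
move=> c x y /asboolP[a ->] /asboolP[b ->]; apply/asboolP.
exists (fun i => (a i * (c : R) + b i)).
rewrite scaler_sumr -big_split /=; apply: eq_bigr => i _.
by rewrite scalerA -scalerDl.
Qed.
HB.instance Definition _ := GRing.isSubmodClosed.Build R^c Q span_pred span_closed.

Lemma span_predP x : x \in span_pred <-> exists a : I -> R, x = \sum_i (a i : R^c) *: q i.
Proof. by rewrite /span_pred unfold_in; split=> /asboolP. Qed.

(** The tuples f for which the sum of the q i (x) f i vanishes for the formal
    reason that f factors over a matrix killed by q. *)
Definition null_pred : {pred product (fun _ : I => M)} := fun f =>
  `[< exists (J : finType) (A : I -> J -> R) (y : J -> M),
       f =1 combo A y /\ forall j, \sum_i (A i j : R^c) *: q i = 0 >].

Lemma null_closed : zmod_closed null_pred.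
Proof.
split.
  apply/asboolP; exists void, (fun _ (v : void) => match v with end), (fun v : void => match v with end).
  by split=> [i|[]//]; rewrite /combo big1 // => -[].
move=> f g /asboolP[J [A [y [fA qA]]]] /asboolP[K [B [z [gB qB]]]]; apply/asboolP.
exists (J + K)%type, (fun i => join (A i) (fun k => - B i k)), (join y z); split=> [i|[j|k] /=].
- rewrite /combo big_sumType /= -[LHS]/(f i - g i) fA gB; congr (_ + _).
  by rewrite /combo -sumrN; apply: eq_bigr => k _; rewrite scaleNr.
- exact: qA.
- by under eq_bigr do rewrite scaleNr; rewrite sumrN qB oppr0.
Qed.
HB.instance Definition _ :=
  GRing.isZmodClosed.Build (product (fun _ : I => M)) null_pred null_closed.

Let Z := Quotient.quot null_pred.
HB.instance Definition _ := GRing.Zmodule.on Z.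
HB.instance Definition _ := EqQuotient.on Z.

Let piB (f g : product (fun _ : I => M)) : \pi_Z (f - g) = \pi_Z f - \pi_Z g.
Proof. by rewrite !piE. Qed.

Let piE0 (f g : product (fun _ : I => M)) : \pi_Z f = \pi_Z g <-> f - g \in null_pred.
Proof.
rewrite -[f - g \in null_pred]/(Quotient.equiv null_pred f g).
by split=> [/eqmodP|h] //; apply/eqmodP.
Qed.


Let S : lmodType R^c := submodule span_pred.

Let coef_ex (x : S) : exists a : I -> R, val x = \sum_i (a i : R^c) *: q i.
Proof. exact/span_predP/(valP x). Qed.

Let coef (x : S) : I -> R := sval (cid (coef_ex x)).

(** The coefficients of x over q are determined up to null vectors. *)
Let B (x : S) (y : M) : Z := \pi_Z (fun i => coef x i *: y).

Let BE x y (a : I -> R) : val x = \sum_i (a i : R^c) *: q i ->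
  B x y = \pi_Z (fun i => a i *: y).
Proof.
move=> xa; apply/piE0/asboolP.
exists unit, (fun i _ => coef x i - a i), (fun _ => y); split=> [i|_].
  rewrite /combo (bigD1 tt) //= big1 => [|[]//]; rewrite addr0 scalerBl.
  by [].
under eq_bigr do rewrite scalerBl; rewrite sumrB -xa /coef.
by case: cid => /= b <-; rewrite subrr.
Qed.

Let B_balanced : balanced B.
Proof.
have coefP x : val x = \sum_i (coef x i : R^c) *: q i by rewrite /coef; case: cid.
have piD (f g : product (fun _ : I => M)) : \pi_Z (f + g) = \pi_Z f + \pi_Z g by rewrite !piE.
split=> [x x' y|x y y'|r x y].
- rewrite (@BE _ _ (fun i => coef x i + coef x' i)).
    by rewrite -piD; congr (\pi_Z _); apply: functional_extensionality_dep => i; rewrite scalerDl.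
  by rewrite raddfD /= !coefP -big_split /=; apply: eq_bigr => i _; rewrite -scalerDl.
- by rewrite -piD; congr (\pi_Z _); apply: functional_extensionality_dep => i; rewrite scalerDr.
- rewrite (@BE _ _ (fun i => coef x i * r)).
    by congr (\pi_Z _); apply: functional_extensionality_dep => i; rewrite scalerA.
  by rewrite linearZ /= coefP scaler_sumr; apply: eq_bigr => i _; rewrite scalerA.
Qed.

(** Flatness lets the relation be read in the submodule generated by q, which
    maps to M^I modulo null vectors. *)
Lemma flat_vanish (m : I -> M) : flat M -> small Q -> \sum_i tens (q i) (m i) = 0 ->
  exists (J : finType) (A : I -> J -> R) (y : J -> M),
    m =1 combo A y /\ forall j, \sum_i (A i j : R^c) *: q i = 0.
Proof.
move=> Mflat Qsmall qm0.
have delta i : q i = \sum_k ((k == i)%:R : R^c) *: q k.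
  rewrite (bigD1 i) //= eqxx scale1r big1 ?addr0 // => j /negbTE->.
  by rewrite scale0r.
have qS i : q i \in span_pred.
  by apply/span_predP; exists (fun k => (k == i)%:R).
pose q' i : S := Sub (q i) (qS i).
have qm0' : \sum_i tens (q' i) (m i) = 0.
  pose g : {linear S -> Q} := \val.
  have gI : injective (tensor_map (M := M) g).
    have vI : injective g by move=> x y; exact: val_inj.
    apply: Mflat vI => //; exact: small_inj val_inj Qsmall.
  apply: gI; rewrite tensor_map_sum.
  by rewrite [RHS](tensor_lift0 (tensor_map_balanced M g)).
have lift0 := tensor_lift0 B_balanced.
have pi0 : \pi_Z (0 : product (fun _ : I => M)) = 0 by rewrite -[0 in LHS](subrr 0) piB subrr.
have piD : {morph \pi_Z : f g / f + g} by move=> f g; rewrite !piE.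
have : \pi_Z (m : product (fun _ : I => M)) = \pi_Z 0.
  rewrite pi0 -lift0 -qm0' (tensor_lift_sum _ _ B_balanced).
  have BqE i : B (q' i) (m i) = \pi_Z (fun k => (k == i)%:R *: m i).
    by apply: BE; exact: delta.
  under [RHS]eq_bigr do rewrite BqE.
  rewrite -(big_morph _ piD pi0); congr (\pi_Z _).
  apply: functional_extensionality_dep => k.
  rewrite (big_morph (fun f : product (fun _ : I => M) => f k) (id1 := 0) (op1 := +%R)) //.
  rewrite (bigD1 k) //= eqxx scale1r big1 ?addr0 // => i ik.
  by rewrite eq_sym (negbTE ik) scale0r.
move=> /piE0; rewrite subr0 => /asboolP[J [A [y [mA qA]]]].
by exists J, A, y.
Qed.

End FlatVanish.

Section Criterion.
Variables (R : pzRingType) (Rsmall : small R) (M : lmodType R).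

Definition unit_vector (I : finType) (i : I) : product (fun _ : I => (R^c)^o) :=
  fun k => (k == i)%:R.

Lemma free_sumE (I J : finType) (x : J -> product (fun _ : I => (R^c)^o)) i :
  (\sum_j x j) i = \sum_j x j i.
Proof. by rewrite (big_morph (fun p : product (fun _ : I => (R^c)^o) => p i) (id1 := 0) (op1 := +%R)). Qed.

Lemma scale_unit_vector (I : finType) (a : R) (k i : I) :
  ((a : R^c) *: unit_vector k) i = if i == k then a else 0.
Proof.
by rewrite -[LHS]/((a : R^c) * (i == k)%:R); case: eqP; rewrite ?mulr1 ?mulr0.
Qed.

Lemma free_unit_vector (I : finType) (x : product (fun _ : I => (R^c)^o)) :
  x = \sum_i (x i : R^c) *: unit_vector i.
Proof.
apply: functional_extensionality_dep => i; rewrite free_sumE (bigD1 i) //= big1 => [|k ki].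
  by rewrite addr0 scale_unit_vector eqxx.
by rewrite scale_unit_vector eq_sym (negbTE ki).
Qed.

Lemma small_free (I : finType) : small (product (fun _ : I => (R^c)^o)).
Proof.
apply: small_fun Rsmall; first exact: 0.
apply: small_inj small_nat; exact: (fun t t' e => enum_rank_inj (val_inj e)).
Qed.

(** The relations are the rows of D: the columns of D, paired with m, give a sum
    of tensors over a free module, which vanishes. *)
Lemma flat_equational : flat M -> equational M.
Proof.
move=> Mflat T I D m Dm.
pose F : lmodType R^c := product (fun _ : T => (R^c)^o).
pose q i : F := fun t => D t i.
have Fsmall : small F := small_free T.
have : \sum_i tens (q i) (m i) = 0.
  under eq_bigr do rewrite (free_unit_vector (q _)).
  by rewrite -tens_combo big1 // => t _; rewrite Dm tens0r.
move=> /(flat_vanish Mflat Fsmall)[J [A [y [mA qA]]]].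
exists J, A, y; split=> // t j; have := congr1 (@^~ t) (qA j); rewrite free_sumE.
by apply: etrans; apply: eq_bigr.
Qed.

Lemma pi_quot0 (R' : pzRingType) (M' : lmodType R') (S : submodClosed M') :
  \pi_(quotmodule S) 0 = 0.
Proof. by apply: (addrI (\pi_(quotmodule S) 0)); rewrite -pi_quot_add !addr0. Qed.

Lemma quot_combo (R' : pzRingType) (M' : lmodType R') (S : submodClosed M') (J : finType)
    (c : J -> R') (x : J -> M') :
  \pi_(quotmodule S) (\sum_j c j *: x j) = \sum_j c j *: \pi_(quotmodule S) (x j).
Proof.
rewrite (big_morph _ (pi_quot_add S) (pi_quot0 S)); apply: eq_bigr => j _.
exact: pi_quot_scale.
Qed.

Lemma small_Prop : small Prop.
Proof.
apply: (small_inj (f := asbool)) (@small_type _ (fun _ : bool => vempty)) => P Q e.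
by apply/propext; rewrite -(asboolE P) e asboolE.
Qed.

Section LeastFactor.
Variables (I : finType) (m : I -> M).

Definition columns p (B : I -> 'I_p -> R) (l : 'I_p) : product (fun _ : I => (R^c)^o) :=
  fun i => B i l.

Let F : lmodType R^c := product (fun _ : I => (R^c)^o).

(** Indexing by the submodules over which m factors, rather than by the
    factorizations, makes smallness of the index type immediate. *)
Let factors := {K : set F | exists p (B : I -> 'I_p -> R) (z : 'I_p -> M),
  m =1 combo B z /\ K = [set x | x \in span_pred (columns B)]}.

Let rank (K : factors) : nat := projT1 (cid (svalP K)).
Let mat (K : factors) : I -> 'I_(rank K) -> R := projT1 (cid (projT2 (cid (svalP K)))).
Let matP (K : factors) : exists z : 'I_(rank K) -> M,
  m =1 combo (@mat K) z /\ sval K = [set x | x \in span_pred (columns (@mat K))].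
Proof. exact: projT2 (cid (projT2 (cid (svalP K)))). Qed.

Let Quo (K : factors) : lmodType R^c := quotmodule (span_pred (columns (@mat K))).

Let small_factors : small factors.
Proof.
apply: (@small_inj _ (F -> Prop) (fun K : factors => sval K)) => [[K hK] [K' hK'] /= e|].
  exact: eq_exist.
by apply: small_fun small_Prop; [exact: True|exact: small_free].
Qed.

Let small_Quo K : small (Quo K).
Proof.
apply: (@small_inj (Quo K) F repr) (small_free I) => x y e.
by rewrite -[x]reprK e reprK.
Qed.

Let univ (i : I) : product Quo := fun K => \pi_(Quo K) (unit_vector i).

Let Quo_eq0 K (x : F) : \pi_(Quo K) x = 0 <-> x \in span_pred (columns (@mat K)).
Proof.
by rewrite -(pi_quot0 (span_pred (columns (@mat K)))) pi_quotE subr0.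
Qed.

Let univ0 : mittag_leffler M ->
  \sum_i tens (univ i) (m i) = 0.
Proof.
move=> MML; apply: (MML _ _ small_factors small_Quo).
apply: functional_extensionality_dep => K; rewrite prod_tensor_map_sum.
have [w [mw _]] := matP K.
have -> : prod_tensor_map (0 : tensor (product Quo) M) K = 0.
  exact: tensor_lift0 (prod_tensor_balanced M Quo K).
apply: tens_combo0 mw _ => j; rewrite /univ.
rewrite -(quot_combo _ (fun i => (@mat K i j : R^c))); apply/Quo_eq0.
rewrite -(free_unit_vector (columns (@mat K) j)).
apply/span_predP; exists (fun l => (l == j)%:R); rewrite (bigD1 j) //= eqxx scale1r.
by rewrite big1 ?addr0 // => l /negbTE->; rewrite scale0r.
Qed.

(** In the product of the quotients of R^I by the submodules over which m
    factors, the unit vectors kill m; the resulting factorization lies in each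
    of these submodules. *)
Lemma flat_mittag_leffler_minimal_factor : flat M -> mittag_leffler M ->
  exists (J : finType) (A : I -> J -> R) (y : J -> M), minimal_factor m A y.
Proof.
move=> /flat_equational Meq /univ0 /(tensor_vanish Meq)[J [A [y [mA univA]]]].
exists J, A, y; split=> // T K D B z DB.
(* factoring m and z together turns D m = B z into an identity of matrices *)
have [|L [E [w [mzE DE0]]]] :=
    Meq T (I + K)%type (fun t => join (D t) (fun k => - B t k)) (join m z).
  move=> t; rewrite /combo big_sumType /= -[X in X + _]/(combo D m t) DB.
  under [X in _ + X]eq_bigr do rewrite scaleNr.
  by rewrite sumrN subrr.
pose E1 i l := E (inl i) l; pose E2 k l := E (inr k) l.
have DB12 t l : mmul D E1 t l = mmul B E2 t l.
  apply/eqP; rewrite -subr_eq0; apply/eqP; rewrite -[RHS](DE0 t l) /mmul big_sumType /=.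
  by congr (_ + _); rewrite -sumrN; apply: eq_bigr => k _; rewrite mulNr.
pose B' i (l : 'I_#|L|) := E1 i (enum_val l).
have mB' : m =1 combo B' (fun l => w (enum_val l)).
  move=> i; apply: etrans (mzE (inl i)) _; rewrite /combo (reindex (enum_val : 'I_#|L| -> L)) //=.
  by apply: onW_bij; exact: enum_val_bij.
have K0P : exists p (C : I -> 'I_p -> R) (z : 'I_p -> M), m =1 combo C z /\
    [set x | x \in span_pred (columns B')] = [set x | x \in span_pred (columns C)].
  by exists #|L|, B', (fun l => w (enum_val l)).
pose K0 : factors := exist _ _ K0P.
have [_ [_ K0E]] := matP K0.
have colA j : exists c : 'I_#|L| -> R, forall i, A i j = \sum_l B' i l * c l.
  have : columns (fun i (_ : 'I_1) => A i j) ord0 \in span_pred (columns (@mat K0)).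
    apply/Quo_eq0; rewrite (free_unit_vector (columns _ _)).
    rewrite quot_combo -[RHS]/((0 : product Quo) K0) -(univA j).
    by rewrite (big_morph (fun p : product Quo => p K0) (id1 := 0) (op1 := +%R)).
  have e := congr1 (fun X : set F => X (columns (fun i (_ : 'I_1) => A i j) ord0)) K0E.
  rewrite /= in e; rewrite -e => /span_predP[c cE].
  exists c => i; have := congr1 (@^~ i) cE; rewrite free_sumE => h.
  by apply: etrans h _; apply: eq_bigr.
have [C CE] := choice colA.
pose C' l j := C j (enum_rank l).
have AC i j : A i j = mmul E1 C' i j.
  rewrite CE /mmul (reindex (enum_val : 'I_#|L| -> L)) /=; last by apply: onW_bij; exact: enum_val_bij.
  by apply: eq_bigr => l _; rewrite /C' enum_valK.
exists (mmul E2 C') => t j; rewrite -mmulA -(eq_mmull _ _ (DB12 t)) mmulA.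
exact: eq_mmulr.
Qed.

End LeastFactor.

Lemma flat_mittag_leffler_factorizable : flat_mittag_leffler M <-> factorizable M.
Proof.
split=> [[Mflat MML] I m|Mf]; first exact: flat_mittag_leffler_minimal_factor.
by split; [exact: factorizable_flat|exact: factorizable_mittag_leffler].
Qed.

End Criterion.

(** * Small submodules retract into a closed elementary substructure *)

Section Retraction.
Variables (R : pzRingType) (L : signature R) (N : V).
Let T := (R + nat)%type.
Let kappa := succ_cardinal T.
Hypotheses (Napp : appropriate L N) (Ncl : lt_closed kappa N).

Let Tsmall : small T := small_ring_nat L.
Let natT : [set: nat] #<= [set: T] := nat_le_ring_nat R.

Let Nel : Sigma1_elementary N. Proof. by have [_ _] := Napp. Qed.

Let small_setT U (C : set U) (g : U -> V) : C #<= [set: T] -> vsmall (g @` C).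
Proof.
have /smallP[x Tx] := Tsmall => CT; apply: (card_le_vsmall (card_image_le _ _)).
by exists x; apply: card_le_trans CT Tx.
Qed.

Lemma closed_image U (C : set U) (g : U -> V) : C #<= [set: T] ->
  (forall u, C u -> g u ∈ N) -> vset (g @` C) ∈ N.
Proof.
move=> CT gN; have Ce := vsetE (small_setT g CT).
apply: Ncl; rewrite Ce; first by move=> _ [u Cu <-]; exact: gN.
apply/(card_lt_succ_cardinal Tsmall); apply: card_le_trans CT; exact: card_image_le.
Qed.

Lemma finite_le_ring_nat U (C : set U) : finite_set C -> C #<= [set: T].
Proof. by move=> /finite_set_countable Cc; apply: card_le_trans Cc natT. Qed.

Lemma closed_vset2 x y : x ∈ N -> y ∈ N -> vset [set x; y] ∈ N.
Proof.
move=> xN yN; rewrite -[[set x; y]]image_id; apply: closed_image.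
  exact/finite_le_ring_nat/finite_set2.
by move=> _ [->|->].
Qed.

Lemma closed_vpair x y : x ∈ N -> y ∈ N -> vpair x y ∈ N.
Proof.
by move=> xN yN; apply: closed_vset2; [rewrite -(setUid [set x])|]; exact: closed_vset2.
Qed.

(** Otherwise N would be small enough to be an element of itself. *)
Lemma closed_large : exists j : T -> V, injective j /\ forall t, j t ∈ N.
Proof.
have kN : elts kappa #<= elts N.
  have [//|Nk] := card_le_total (elts kappa) (elts N).
  apply: contrapT => kN; apply: (@vmem_irr N); apply: Ncl => //.
have [[_ [Tk _] _] _ _] := succ_cardinal_spec_min Tsmall.
have [j [jN jI]] := card_le_ex vempty (card_le_trans Tk kN).
by exists j; split=> [t t'|t]; [exact: jI|exact: jN].
Qed.

Variables (M : lmodType R) (f : M -> V) (k : V).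
Hypotheses (fk : codes L f k) (kN : k ∈ N).

Let fI : injective f. Proof. by have [] := fk. Qed.

Let Msmall : small M.
Proof. by have [_ [A AE] _] := fk; exists f, A. Qed.

Let small_MM : small (M * M).
Proof.
apply: (@small_inj _ (bool -> M) (fun z b => if b then z.1 else z.2)).
  move=> [x y] [x' y'] e; have /= -> := congr1 (@^~ true) e.
  by have /= -> := congr1 (@^~ false) e.
by apply: small_fun Msmall; [exact: 0|exact: (@small_type _ (fun=> vempty))].
Qed.

Let vsmall_range_small U (g : U -> V) : small U -> vsmall (range g).
Proof.
by move=> /smallP[x Ux]; apply: (card_le_vsmall (card_image_le _ _)); exists x.
Qed.

Let in_add p : p ∈ interp f Sadd <-> exists x y, p = vpair (vpair (f x) (f y)) (f (x + y)).
Proof.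
rewrite in_vset; last exact/vsmall_range_small/small_MM.
by split=> [[[x y] _ <-]|[x [y ->]]]; [exists x, y|exists (x, y)].
Qed.

Let in_scale r p : p ∈ interp f (Sscale r) <-> exists x, p = vpair (f x) (f (r *: x)).
Proof.
rewrite in_vset; last exact/vsmall_range_small/Msmall.
by split=> [[x _ <-]|[x ->]]; exists x.
Qed.

(** The graph of a symbol is found in two steps, from the code and its second part. *)
Lemma interp_mem s : interp f s ∈ N.
Proof.
have [symN _ _] := Napp; have [_ _ kE] := fk.
set I := vset (range (fun s => vpair (sym L s) (interp f s))) in kE.
have IN : I ∈ N.
  have [||A [J [AN JN]]] := @Sigma1_elementary_witness N
    (fun e A J => e 0%N = vpair A J) Nel _ (fun=> k) (fun=> kN).
  - by apply: bounded_pair; bounded_var_tac.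
  - by exists (vset (range f)), I.
  - by rewrite kE => /vpair_inj[_ ->].
have inI p : p ∈ I <-> exists s, p = vpair (sym L s) (interp f s).
  rewrite in_vset; last exact/vsmall_range_small/(small_symbol L).
  by split=> [[s' _ <-]|[s' ->]]; exists s'.
have sN : sym L s ∈ N by apply: symN; rewrite sig_setE; exists s.
have [|||g [w [gN wN [wI wE]]]] := @Sigma1_elementary_witness N
    (fun e g w => w ∈ e 0%N /\ w = vpair (e 1%N) g) Nel _
    (nth I [:: I; sym L s]) _.
- by apply: bounded_and; [apply: bounded_mem|apply: bounded_pair]; bounded_var_tac.
- by move=> [|[|i]] //=; rewrite nth_nil.
- by exists (interp f s), (vpair (sym L s) (interp f s)); split=> //=; apply/inI; exists s.
- move: wI => /inI[s' ws']; move: wE; rewrite ws' => /vpair_inj[/sym_inj <- ->].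
  exact: gN.
Qed.

(** The statement that is reflected: h maps the names of the elements of a
    submodule to M and respects the sums, multiples and constants tabulated in
    e 0, e 1 and e 2, where e 3 is the addition of M. The set U bounds the
    quantifiers. *)
Let hom_stmt (e : nat -> V) (U h : V) : Prop :=
  (forall c, c ∈ e 2%N -> exists a, a ∈ U /\ exists x, x ∈ U /\
     (c = vpair a x /\ c ∈ h)) /\
  (forall t, t ∈ e 0%N -> exists a, a ∈ U /\ exists b, b ∈ U /\ exists c, c ∈ U /\
     exists x, x ∈ U /\ exists y, y ∈ U /\ exists z, z ∈ U /\
     (t = vpair a (vpair b c) /\ vpair a x ∈ h /\ vpair b y ∈ h /\ vpair c z ∈ h /\
      vpair (vpair x y) z ∈ e 3)) /\
  (forall t, t ∈ e 1%N -> exists g, g ∈ U /\ exists a, a ∈ U /\ exists b, b ∈ U /\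
     exists x, x ∈ U /\ exists y, y ∈ U /\
     (t = vpair g (vpair a b) /\ vpair a x ∈ h /\ vpair b y ∈ h /\ vpair x y ∈ g)) /\
  (forall a, a ∈ U -> forall x, x ∈ U -> forall y, y ∈ U ->
     vpair a x ∈ h -> vpair a y ∈ h -> x = y).

Let hom_stmt_bounded :
  bounded_def (push (push id)) (fun z => hom_stmt z.1.1 z.1.2 z.2).
Proof.
rewrite /hom_stmt.
bounded_tac; first [apply: bounded_triple | apply: bounded_pair_pair_mem
  | apply: bounded_pair_mem | apply: bounded_pair]; bounded_var_tac.
Qed.

Section Small.
Variable X : set M.
Hypotheses (XT : X #<= [set: T]).
Hypotheses (XD : forall x y, X x -> X y -> X (x + y)) (XZ : forall r x, X x -> X (r *: x)).

Let prod_le (U : Type) (C : set U) : [set: U] #<= [set: T] -> C `*` X #<= [set: T].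
Proof.
move=> UT; apply: card_le_trans (card_square_le natT).
have [j jI] := card_le_exT UT; have [i [_ iI]] := card_le_ex (inr 0%N : T) XT.
apply: (@card_le_fun _ _ _ _ (fun z => (j z.1, i z.2))) => // -[u x] [u' x'] [_ Xx] [_ Xx'].
by move=> [/jI -> /iI ->].
Qed.

(** The elements of X get names in N; the tables of X in terms of these names are
    small subsets of N, hence elements of N, and N contains a map h that respects
    them. The map theta reads off the values of h. *)
Lemma retraction_on : exists theta : M -> M, [/\ forall x, X x -> f (theta x) ∈ N,
  forall x, X x -> f x ∈ N -> theta x = x,
  forall x y, X x -> X y -> theta (x + y) = theta x + theta y
& forall r x, X x -> theta (r *: x) = r *: theta x].
Proof.
have [j0 [j0I j0N]] := closed_large.
have [i [_ iI]] := card_le_ex (inr 0%N : T) XT.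
pose j x := j0 (i x).
have jN x : j x ∈ N by exact: j0N.
have jI x y : X x -> X y -> j x = j y -> x = y.
  by move=> Xx Xy /j0I; exact: iI.
pose sums (z : M * M) := vpair (j z.1) (vpair (j z.2) (j (z.1 + z.2))).
pose mults (z : R * M) := vpair (interp f (Sscale z.1)) (vpair (j z.2) (j (z.1 *: z.2))).
pose graph x := vpair (j x) (f x).
have sT : X `*` X #<= [set: T].
  apply: card_le_trans (card_square_le natT).
  by apply: (@card_le_fun _ _ _ _ (fun z => (i z.1, i z.2))) => // -[x y] [x' y'] [/= ? ?] [/= ? ?] [/iI -> // /iI ->].
have mT : [set: R] `*` X #<= [set: T].
  by apply: prod_le; apply: (card_le_inj (f := inl)) => ? ? [].
have cT : X `&` [set x | f x ∈ N] #<= [set: T].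
  by apply: card_le_trans XT; apply: subset_card_le => x [].
pose e := nth (vset (sums @` (X `*` X))) [:: vset (sums @` (X `*` X));
  vset (mults @` ([set: R] `*` X)); vset (graph @` (X `&` [set x | f x ∈ N])); interp f Sadd].
have eN n : e n ∈ N.
  have sN : vset (sums @` (X `*` X)) ∈ N.
    by apply: closed_image => // -[x y] _; do 2?[apply: closed_vpair => //].
  have mN : vset (mults @` ([set: R] `*` X)) ∈ N.
    apply: closed_image => // -[r x] _.
    by apply: closed_vpair; [exact: interp_mem|exact: closed_vpair].
  have cN : vset (graph @` (X `&` [set x | f x ∈ N])) ∈ N.
    by apply: closed_image => // x [_ fxN]; exact: closed_vpair.
  case: n => [|[|[|[|n]]]] //=; first exact: interp_mem.
  by rewrite /e /= nth_nil.
have in_sums t : t ∈ e 0%N <-> exists x y, [/\ X x, X y & t = sums (x, y)].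
  rewrite in_vset; last exact: small_setT.
  by split=> [[[x y] [Xx Xy] <-]|[x [y [Xx Xy ->]]]]; [exists x, y|exists (x, y)].
have in_mults t : t ∈ e 1%N <-> exists r x, X x /\ t = mults (r, x).
  rewrite in_vset; last exact: small_setT.
  by split=> [[[r x] [_ Xx] <-]|[r [x [Xx ->]]]]; [exists r, x|exists (r, x)].
have in_consts t : t ∈ e 2%N <-> exists x, [/\ X x, f x ∈ N & t = graph x].
  rewrite in_vset; last exact: small_setT.
  by split=> [[x [Xx fx] <-]|[x [Xx fx ->]]]; exists x.
have [|U [h [UN hN [hc [hs [hm hf]]]]]] :=
    @Sigma1_elementary_witness N hom_stmt Nel hom_stmt_bounded e eN.
  (* in V, the map sending the name of x to f x is a witness *)
  pose U := j @` X `|` f @` X `|` range (fun r => interp f (Sscale r)).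
  have Us : vsmall U.
    apply: vsmallU; first by apply: vsmallU; exact: small_setT.
    exact/vsmall_range_small/(small_ring L).
  pose h := graph @` X; have hs : vsmall h by exact: small_setT.
  have jU x : X x -> j x ∈ vset U by move=> Xx; apply/in_vset => //; left; left; exists x.
  have fU x : X x -> f x ∈ vset U by move=> Xx; apply/in_vset => //; left; right; exists x.
  have gU r : interp f (Sscale r) ∈ vset U by apply/in_vset => //; right; exists r.
  have hX x : X x -> vpair (j x) (f x) ∈ vset h by move=> Xx; apply/in_vset => //; exists x.
  exists (vset U), (vset h); split; [|split; [|split]].
  - move=> c /in_consts[x [Xx fx ->]]; exists (j x); split; first exact: jU.
    by exists (f x); split; [exact: fU|split=> //; exact: hX].
  - move=> t /in_sums[x [y [Xx Xy ->]]]; have Xxy := XD Xx Xy.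
    exists (j x); split; first exact: jU. exists (j y); split; first exact: jU.
    exists (j (x + y)); split; first exact: jU. exists (f x); split; first exact: fU.
    exists (f y); split; first exact: fU. exists (f (x + y)); split; first exact: fU.
    split=> //; do 3!(split; first exact: hX).
    by apply/in_add; exists x, y.
  - move=> t /in_mults[r [x [Xx ->]]]; have Xrx := XZ r Xx.
    exists (interp f (Sscale r)); split => //.
    exists (j x); split; first exact: jU. exists (j (r *: x)); split; first exact: jU.
    exists (f x); split; first exact: fU. exists (f (r *: x)); split; first exact: fU.
    split=> //; do 2!(split; first exact: hX).
    by apply/in_scale; exists x.
  - move=> a _ u _ v _ /(in_vset _ hs)[x Xx /vpair_inj[<- <-]].
    by move=> /(in_vset _ hs)[y Xy /vpair_inj[/jI e' <-]]; rewrite e'.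
pose val x m := [/\ j x ∈ U, f m ∈ U & vpair (j x) (f m) ∈ h].
have val_uniq x m n : val x m -> val x n -> m = n.
  by move=> [jx fm xm] [_ fn xn]; apply: fI; exact: hf xm xn.
have valD x y : X x -> X y -> exists m n, [/\ val x m, val y n & val (x + y) (m + n)].
  move=> Xx Xy; have : sums (x, y) ∈ e 0%N by apply/in_sums; exists x, y.
  move=> /hs[a [aU [b [bU [c [cU [u [uU [v [vU [w [wU [t [au [bv [cw uvw]]]]]]]]]]]]]]]].
  move: t => /vpair_inj[xa /vpair_inj[yb xyc]].
  move: uvw => /in_add[m [n /vpair_inj[/vpair_inj[um vn] wmn]]].
  by exists m, n; rewrite /val /= in xa yb xyc *; rewrite xa yb xyc -um -vn -wmn.
have valZ r x : X x -> exists m, val x m /\ val (r *: x) (r *: m).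
  move=> Xx; have : mults (r, x) ∈ e 1%N by apply/in_mults; exists r, x.
  move=> /hm[g [gU [a [aU [b [bU [u [uU [v [vU [t [au [bv uvg]]]]]]]]]]]]].
  move: t => /vpair_inj[gE /vpair_inj[xa rxb]].
  move: uvg; rewrite -gE => /in_scale[m /vpair_inj[um vm]].
  by exists m; rewrite /val /= in xa rxb *; rewrite xa rxb -um -vm.
have /choice[theta thetaP] x : exists m, X x -> val x m.
  have [Xx|nX] := pselect (X x); last by exists 0.
  by have [m [? _]] := valZ 0 x Xx; exists m.
exists theta; split.
- move=> x Xx; have [jxU tU xt] := thetaP _ Xx.
  have [|||v [_ [vN _ [vU xv]]]] := @Sigma1_elementary_witness N
    (fun e v _ => v ∈ e 1%N /\ vpair (e 0%N) v ∈ e 2%N) Nel _ (nth h [:: j x; U; h]) _.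
  + by apply: bounded_and; [apply: bounded_mem|apply: bounded_pair_mem]; bounded_var_tac.
  + by move=> [|[|[|n]]] //=; rewrite nth_nil.
  + by exists (f (theta x)), h.
  + by rewrite (hf _ jxU _ tU _ vU xt xv).
- move=> x Xx fx; have : graph x ∈ e 2%N by apply/in_consts; exists x.
  move=> /hc[a [aU [v [vU [/vpair_inj[xa xv] xh]]]]].
  apply: (val_uniq x) (thetaP _ Xx) _; split=> //; first by rewrite xa.
  by rewrite xv.
- move=> x y Xx Xy; have [m [n [xm yn xymn]]] := valD _ _ Xx Xy.
  rewrite (val_uniq _ _ _ (thetaP _ Xx) xm) (val_uniq _ _ _ (thetaP _ Xy) yn).
  exact: val_uniq (thetaP _ (XD Xx Xy)) xymn.
- move=> r x Xx; have [m [xm rxm]] := valZ r _ Xx.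
  rewrite (val_uniq _ _ _ (thetaP _ Xx) xm).
  exact: val_uniq (thetaP _ (XZ r Xx)) rxm.
Qed.

End Small.

(** An element of the submodule generated by G is given by a finite sequence in
    R * G, so that this submodule is no larger than R + nat. *)
Lemma retraction (G : set M) : G #<= [set: T] -> exists (X : set M) (theta : M -> M),
  [/\ G `<=` X, X 0, forall x y, X x -> X y -> X (x + y) & forall r x, X x -> X (r *: x)] /\
  [/\ forall x, X x -> f (theta x) ∈ N,
  forall x, X x -> f x ∈ N -> theta x = x,
  forall x y, X x -> X y -> theta (x + y) = theta x + theta y
& forall r x, X x -> theta (r *: x) = r *: theta x].
Proof.
move=> GT.
pose X := [set x | exists2 s : seq (R * M), (forall c, c \in s -> G c.2) & x = \sum_(c <- s) c.1 *: c.2].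
have X0 : X 0 by exists [::]; rewrite // big_nil.
have XD x y : X x -> X y -> X (x + y).
  move=> [s Gs ->] [t Gt ->]; exists (s ++ t); rewrite ?big_cat // => c.
  by rewrite mem_cat => /orP[/Gs|/Gt].
have XZ r x : X x -> X (r *: x).
  move=> [s Gs ->]; exists [seq (r * c.1, c.2) | c <- s].
    by move=> _ /mapP[c /Gs ? ->].
  by rewrite big_map scaler_sumr; apply: eq_bigr => c _; rewrite scalerA.
have GX : G `<=` X.
  move=> x Gx; exists [:: (1, x)]; last by rewrite big_seq1 scale1r.
  by move=> c; rewrite inE => /eqP->.
have XT : X #<= [set: T].
  apply: card_le_trans (card_seq_le natT).
  have [p pI] := card_le_squareP natT.
  have [i [_ iI]] := card_le_ex (inr 0%N : T) GT.
  pose code (c : R * M) : T := p (inl c.1) (i c.2).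
  apply: (@card_le_rel _ _ _ _ (fun x t => exists s : seq (R * M),
    [/\ forall c, c \in s -> G c.2, x = \sum_(c <- s) c.1 *: c.2 & t = map code s])).
    by move=> x [s Gs ->]; exists (map code s) => //; exists s.
  move=> x x' t _ _ [s [Gs -> ->]] [s' [Gs' ->]] e; suff -> : s = s' by [].
  elim: s s' Gs Gs' e => [|c s IH] [|c' s'] //= Gs Gs' [/pI[[e1] e2] e3].
  have e2' := iI _ _ (Gs _ (mem_head _ _)) (Gs' _ (mem_head _ _)) e2.
  have -> : c = c' by move: c c' e1 e2' {Gs Gs' e2} => [? ?] [? ?] /= -> ->.
  congr cons; apply: IH => // d ds; [apply: Gs|apply: Gs']; by rewrite inE ds orbT.
have [theta thP] := retraction_on XT XD XZ.
by exists X, theta.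
Qed.

End Retraction.

(** * The Kaplansky property *)

Section SubQuotient.
Variables (R : pzRingType) (M : lmodType R) (S : submodClosed M).
Let T := (R + nat)%type.

Lemma submodN x : x \in S -> - x \in S.
Proof. by move=> xS; rewrite -scaleN1r rpredZ. Qed.

Definition retracts (X : set M) (theta : M -> M) : Prop :=
  [/\ X 0, forall x y, X x -> X y -> X (x + y) & forall r x, X x -> X (r *: x)] /\
  [/\ forall x, X x -> theta x \in S,
  forall x, X x -> x \in S -> theta x = x,
  forall x y, X x -> X y -> theta (x + y) = theta x + theta y
& forall r x, X x -> theta (r *: x) = r *: theta x].

Lemma retracts_combo X theta (I J : finType) (A : I -> J -> R) (y : J -> M) i :
  retracts X theta -> (forall j, X (y j)) ->
  X (combo A y i) /\ theta (combo A y i) = combo A (theta \o y) i.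
Proof.
move=> [[X0 XD XZ] [_ _ tD tZ]] Xy.
have t0 : theta 0 = 0 by rewrite -[0 in LHS](scale0r 0) tZ // scale0r.
rewrite /combo; apply: (big_ind2 (fun u v => X u /\ theta u = v)) => //.
  by move=> u u' v v' [Xu <-] [Xv <-]; rewrite tD //; split=> //; exact: XD.
by move=> j _; rewrite tZ //; split=> //; exact: XZ.
Qed.

Hypothesis retr : forall G : set M, G #<= [set: T] ->
  exists (X : set M) (theta : M -> M), G `<=` X /\ retracts X theta.
Hypothesis Mf : factorizable M.

Let finite_le U (C : set U) : finite_set C -> C #<= [set: T] := @finite_le_ring_nat R U C.

Let finite_range (I : finType) U (g : I -> U) : finite_set (range g).
Proof. exact/finite_image/finite_finset. Qed.

Lemma val_combo (I J : finType) (A : I -> J -> R) (y : J -> submodule S) i :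
  val (combo A y i) = combo A (val \o y) i.
Proof.
have valZ r (x : submodule S) : val (r *: x) = r *: val x by rewrite linearZ.
by rewrite /combo raddf_sum; apply: eq_bigr => j _; apply: valZ.
Qed.

(** A retraction moves a minimal factorization in M of a tuple of S into S. *)
Lemma factorizable_submodule : factorizable (submodule S).
Proof.
move=> I m; have [J [A [y [mA Amin]]]] := Mf (val \o m).
have [|X [theta [GX th]]] := retr (G := range (val \o m) `|` range y).
  by apply: finite_le; rewrite finite_setU; split; exact: finite_range.
have Xy j : X (y j) by apply: GX; right; exists j.
have [_ [tS tfix _ _]] := th.
exists J, A, (fun j => Sub (theta (y j)) (tS _ (Xy j))); split=> [i|U K D B z DB].
  apply: val_inj; rewrite val_combo; have [_ tA] := retracts_combo A i th Xy.
  rewrite -[RHS]/(combo A (theta \o y) i) -tA -mA /= tfix //; last exact: valP.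
  by apply: GX; left; exists i.
apply: Amin (val \o z) _ => t; have := congr1 val (DB t).
by rewrite !val_combo.
Qed.

Lemma quotmodule_combo (I J : finType) (A : I -> J -> R) (y : J -> M) i :
  \pi_(quotmodule S) (combo A y i) = combo A (fun j => \pi_(quotmodule S) (y j)) i.
Proof. exact: quot_combo. Qed.

Lemma combo_sub (I J : finType) (A : I -> J -> R) (y z : J -> M) i :
  combo A (fun j => y j - z j) i = combo A y i - combo A z i.
Proof. by rewrite /combo -sumrB; apply: eq_bigr => j _; rewrite scalerBr. Qed.

(** S is pure in M: a retraction moves a solution of a finite system with
    constants in S into S. *)
Lemma retracts_pure (U I K : finType) (D : U -> I -> R) (B : U -> K -> R)
    (m : I -> M) (z : K -> M) : (forall u, combo D m u - combo B z u \in S) ->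
  exists m' z', [/\ forall i, m' i \in S, forall k, z' k \in S
   & combo D (fun i => m i - m' i) =1 combo B (fun k => z k - z' k)].
Proof.
move=> sS; have [|X [theta [GX th]]] := retr (G := range m `|` range z).
  by apply: finite_le; rewrite finite_setU; split; exact: finite_range.
have [[_ XD XZ] [tS tfix tD tZ]] := th.
have Xm i : X (m i) by apply: GX; left; exists i.
have Xz k : X (z k) by apply: GX; right; exists k.
exists (theta \o m), (theta \o z); split=> [i|k|u]; try exact: tS.
have [XDm tDm] := retracts_combo D u th Xm; have [XBz tBz] := retracts_combo B u th Xz.
have XN : X (-1 *: combo B z u) by exact: XZ.
have := tfix _ (XD _ _ XDm XN); rewrite scaleN1r => /(_ (sS u)).
rewrite -scaleN1r tD // tZ // tDm tBz !scaleN1r !combo_sub => e.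
have -> : combo D m u = combo D (theta \o m) u - combo B (theta \o z) u + combo B z u.
  by rewrite e subrK.
by rewrite addrAC [_ - combo B (theta \o z) u]addrC addrK addrC.
Qed.

Section Quotient.
Variables (I : finType) (m : I -> M).

Let matrices := {p : nat & I -> 'I_p -> R}.

Let matrices_le : [set: matrices] #<= [set: T].
Proof.
apply: card_le_trans (card_seq_le (nat_le_ring_nat R)).
pose code (A : matrices) : seq T :=
  inr (tag A) :: [seq inl (tagged A ij.1 ij.2) | ij <- enum {: I * 'I_(tag A)}].
apply: (card_le_inj (f := code)) => -[p A] [q B] /= [pq]; subst q.
move=> /eq_in_map e; congr existT; apply: funext => i; apply: funext => j.
by have [] := e (i, j) (mem_enum _ _).
Qed.

Definition minimal_at (A : matrices) (s : I -> M) (y : 'I_(tag A) -> M) : Prop :=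
  (forall i, s i \in S) /\ minimal_factor (fun i => m i + s i) (tagged A) y.
Arguments minimal_at : clear implicits.

Lemma factorizable_matrix (s : I -> M) : (forall i, s i \in S) ->
  exists (A : matrices) y, minimal_at A s y.
Proof.
move=> sS; have [J [A [y [mA Amin]]]] := Mf (fun i => m i + s i).
exists (Tagged (fun p => I -> 'I_p -> R) (fun i (j : 'I_#|J|) => A i (enum_val j))).
exists (fun j => y (enum_val j)); split=> //; split=> [i|U K D B z DB] /=.
  rewrite mA /combo (reindex (enum_val : 'I_#|J| -> J)) //.
  by apply: onW_bij; exact: enum_val_bij.
have [C AC] := Amin _ _ _ _ _ DB.
by exists (fun k j => C k (enum_val j)) => u j; exact: AC.
Qed.

(** One choice of s and y for each matrix A that occurs gives at most |R| + aleph_0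
    elements; a retraction finds in S a tuple m' that factors with these s over
    the same matrices, so that m - m' factors over all of them. *)
Lemma least_minimal_factor : exists (A : matrices) s y, minimal_at A s y /\
  forall (A' : matrices) s' y', minimal_at A' s' y' ->
    exists C, tagged A =2 mmul (tagged A') C.
Proof.
pose P := [set A : matrices | exists s y, minimal_at A s y].
have wex (A : matrices) : exists sy : (I -> M) * ('I_(tag A) -> M),
    P A -> minimal_at A sy.1 sy.2.
  have [[s [y h]]|nA] := pselect (P A); first by exists (s, y).
  by exists (fun=> 0, fun=> 0).
pose w A := sval (cid (wex A)); have wP A : P A -> minimal_at A (w A).1 (w A).2 := svalP (cid (wex A)).
pose G := range m `|` \bigcup_(A in P) (range (w A).1 `|` range (w A).2).
have natT := nat_le_ring_nat R.
have [|X [theta [GX th]]] := retr (G := G).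
  apply: (card_setU_le natT); first exact/finite_le/finite_range.
  apply: (card_bigcup_le natT) => [|A _]; first exact: card_le_trans (card_leT _) matrices_le.
  by apply: (card_setU_le natT); exact/finite_le/finite_range.
have [[_ XD _] [tS tfix tD _]] := th.
have Xm i : X (m i) by apply: GX; left; exists i.
have Xs A i : P A -> X ((w A).1 i) by move=> PA; apply: GX; right; exists A => //; left; exists i.
have Xy A j : P A -> X ((w A).2 j) by move=> PA; apply: GX; right; exists A => //; right; exists j.
pose s0 i := - theta (m i).
have s0S i : s0 i \in S by apply: submodN; exact: tS.
have [A0 [y0 A0min]] := factorizable_matrix s0S.
exists A0, s0, y0; split=> // A' s' y' A'min.
have PA' : P A' by exists s', y'.
have [sS [mA _]] := wP _ PA'.
apply: (minimal_factor_divides A0min.2 (z := fun j => (w A').2 j - theta ((w A').2 j))) => i.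
have [_ tA] := retracts_combo (tagged A') i th (fun j => Xy A' j PA').
rewrite combo_sub -[X in _ = _ - X]tA -mA (tD _ _ (Xm i) (Xs _ i PA')).
by rewrite (tfix _ (Xs _ i PA') (sS i)) opprD addrACA subrr addr0.
Qed.

(** The quotient map sends the least minimal factor to a minimal factor: by
    purity, a relation between the images of m lifts to one between some m - m'
    with m' in S. *)
Lemma least_minimal_factor_quotient (A : matrices) s y : minimal_at A s y ->
  (forall (A' : matrices) s' y', minimal_at A' s' y' ->
    exists C, tagged A =2 mmul (tagged A') C) ->
  minimal_factor (fun i => \pi_(quotmodule S) (m i)) (tagged A)
    (fun j => \pi_(quotmodule S) (y j)).
Proof.
move=> [sS [mA _]] Aleast; split=> [i|U K D B z DB].
  rewrite -quotmodule_combo -mA; apply/pi_quotE.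
  by rewrite opprD addrA subrr sub0r; exact: submodN.
have zE : z = fun k => \pi_(quotmodule S) (repr (z k)) by apply: funext => k; rewrite reprK.
have [u|m' [z' [m'S z'S Dm]]] := @retracts_pure U I K D B m (fun k => repr (z k)).
  apply/pi_quotE; rewrite !quotmodule_combo DB; congr (combo _ _ _).
  by rewrite zE; apply: funext => k; rewrite !reprK.
have s'S i : - m' i \in S by apply: submodN.
have [A' [y' A'min]] := factorizable_matrix s'S.
have [C AC] := Aleast _ _ _ A'min.
have [C' DA'] := A'min.2.2 _ _ _ _ _ Dm.
exists (mmul C' C) => u j.
by rewrite (eq_mmulr _ _ _ AC) -mmulA (eq_mmull _ _ (DA' u)) mmulA.
Qed.

End Quotient.

Lemma factorizable_quotmodule : factorizable (quotmodule S).
Proof.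
move=> I m; have mE : m = fun i => \pi_(quotmodule S) (repr (m i)).
  by apply: funext => i; rewrite reprK.
have [A [s [y [Amin Aleast]]]] := least_minimal_factor (fun i => repr (m i)).
exists 'I_(tag A), (tagged A), (fun j => \pi_(quotmodule S) (y j)).
by rewrite mE; exact: least_minimal_factor_quotient Amin Aleast.
Qed.
End SubQuotient.

Section Kaplansky.
Variables (R : pzRingType) (L : signature R).
Let T := (R + nat)%type.
Let kappa := succ_cardinal T.

(** Combinations of elements of N are fixed by theta, as these elements are. *)
Lemma closed_submodule (N : V) (M : lmodType R) (f : M -> V) (k : V) :
  appropriate L N -> lt_closed kappa N -> codes L f k -> k ∈ N ->
  GRing.submod_closed (fun x : M => `[< f x ∈ N >]).
Proof.
move=> Napp Ncl fk kN.
have retr := retraction Napp Ncl fk kN.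
split=> [|c x y /asboolP xN /asboolP yN]; apply/asboolP.
  have [X [theta [[_ X0 _ _] [tN _ _ tZ]]]] := retr set0 (card_ge0 _ _).
  by have := tN _ X0; rewrite -[X in theta X](scale0r 0) tZ // scale0r.
have [|X [theta [[GX X0 XD XZ] [tN tfix tD tZ]]]] := retr [set x; y].
  exact/finite_le_ring_nat/finite_set2.
have Xx : X x by apply: GX; left. have Xy : X y by apply: GX; right.
have Xcx := XZ c _ Xx.
by have := tN _ (XD _ _ Xcx Xy); rewrite tD // tZ // !tfix.
Qed.

Lemma flat_mittag_leffler_kaplansky (lam : V) :
  kaplansky_property L (@flat_mittag_leffler R) (closed_appropriate L kappa lam).
Proof.
move=> N [_ Napp Ncl] M f k fk kN.
have Rsmall := small_ring L.
move=> /(flat_mittag_leffler_factorizable Rsmall) Mf.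
have Scl := closed_submodule Napp Ncl fk kN.
pose S : submodClosed M := HB.pack (fun x : M => `[< f x ∈ N >])
  (GRing.isSubmodClosed.Build R M (fun x : M => `[< f x ∈ N >]) Scl).
have SN x : x \in S <-> f x ∈ N by split=> [/asboolP|h] //; apply/asboolP.
have retr (G : set M) : G #<= [set: T] ->
    exists (X : set M) (theta : M -> M), G `<=` X /\ retracts S X theta.
  move=> /(retraction Napp Ncl fk kN)[X [theta [[GX X0 XD XZ] [tN tfix tD tZ]]]].
  exists X, theta; split=> //; split; split=> //.
    by move=> x Xx; apply/SN; exact: tN.
  by move=> x Xx /SN; exact: tfix.
exists S; split=> //; apply/(flat_mittag_leffler_factorizable Rsmall).
  exact: factorizable_submodule.
exact: factorizable_quotmodule.
Qed.

(** An element of this successor has size at most 2^T, and (2^T)^T = 2^T. *)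
Lemma succ_power_pow (mu : V) : mu ∈ succ_cardinal (T -> bool) ->
  card_lt [set h : T -> V | forall i, h i ∈ mu] (elts (succ_cardinal (T -> bool))).
Proof.
have Tsmall := small_ring_nat L.
have Psmall := small_fun true Tsmall (small_type (fun _ : bool => vempty)).
move=> /(succ_cardinal_mem Psmall) muP; apply/(card_lt_succ_cardinal Psmall).
apply: card_le_trans (card_fun_pow_le (nat_le_ring_nat R)).
have [g [_ gI]] := card_le_ex (fun=> true) muP.
apply: (@card_le_fun _ _ _ _ (fun h => g \o h)) => // h h' hmu hmu' e.
by apply: funext => i; exact: gI (hmu i) (hmu' i) (congr1 (@^~ i) e).
Qed.

End Kaplansky.

Theorem lemma8p1 (R : pzRingType) (L : signature R) :
  let kappa := succ_cardinal (R + nat) in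
  (forall lam : V,
     regular lam ->
     (forall mu : V, cardinal mu -> mu ∈ lam ->
        card_lt [set h : R + nat -> V | forall i, h i ∈ mu] (elts lam)) ->
     stationary lam (closed_appropriate L kappa lam) /\
     kaplansky_property L (@flat_mittag_leffler R)
       (closed_appropriate L kappa lam)) /\
  uniformly_stationary_kaplansky L (succ_cardinal (R + nat -> bool))
    (@flat_mittag_leffler R).
Proof.
move=> kappa; split=> [lam lamR lam_pow|].
  split; last exact: flat_mittag_leffler_kaplansky.
  exact: closed_appropriate_stationary.
have Psmall := small_fun true (small_ring_nat L) (small_type (fun _ : bool => vempty)).
have natP : [set: nat] #<= [set: R + nat -> bool].
  apply: card_le_trans (nat_le_ring_nat R) _.
  apply: (card_le_inj (f := fun t u => `[< t = u >])) => t t' e.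
  by have := congr1 (@^~ t') e; rewrite /= [RHS]asboolT // => /asboolP.
exists (closed_appropriate L kappa (succ_cardinal (R + nat -> bool))); split.
  apply: closed_appropriate_stationary; first exact: succ_cardinal_regular.
  by move=> mu _; exact: succ_power_pow.
exact: flat_mittag_leffler_kaplansky.
Qed.
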